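(* Let $n\ge 3$, let $\mathcal{M}$ be a generic collection of $m$ lines in $\mathbb{P}^n$, and let $R$ be the coordinate ring of $\mathcal{M}$. If $$ m > \frac{1}{72}\left(3(n^2+10n+13)+\sqrt{3(n-1)^3(3n+5)}\right),$$ then $R$ is not Koszul.
   Context: Let $\mathbb{P}^n$ be projective $n$-space over $\mathbb{C}$ with homogeneous coordinate ring $S=\mathbb{C}[x_0,\ldots,x_n]$ (standard grading). The defining ideal of a line in $\mathbb{P}^n$ is the ideal of $S$ of all forms vanishing on it; it is minimally generated by $n-1$ linear forms. For a collection $\mathcal{M}=\{\mathcal{L}_1,\ldots,\mathcal{L}_m\}$ of lines with defining ideals $L_1,\ldots,L_m$, the defining ideal of $\mathcal{M}$ is $J=\bigcap_{i=1}^m L_i$ and the coordinate ring of $\mathcal{M}$ is $R=S/J$. The collection $\mathcal{M}$ is a generic collection if the lines are defined by linear forms ($n-1$ linear forms generating each $L_i$) whose coefficients, all taken together, are algebraically independent over $\mathbb{Q}$. A standard graded $\mathbb{C}$-algebra $R$ is Koszul if $\mathbb{C}=R/\mathfrak{m}_R$ (with $\mathfrak{m}_R$ the maximal homogeneous ideal) has a linear free resolution over $R$, i.e. $\mathrm{Tor}_i^R(\mathbb{C},\mathbb{C})_j=0$ for all $i\neq j$. *)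

(* Defs.v *)
From HB Require Import structures.
From mathcomp Require Import all_boot all_order all_algebra.
From mathcomp Require Import boolp reals complex mpoly.

Set Implicit Arguments.
Unset Strict Implicit.
Unset Printing Implicit Defensive.

Import Order.TTheory GRing.Theory Num.Theory.
Local Open Scope ring_scope.
Local Open Scope quotient_scope.

Section IdealSpan.
Variables (A : comPzRingType) (F : A -> Prop).

Definition ideal_span (p : A) : Prop :=
  exists s : seq (A * A),
    (forall t, t \in s -> F t.2) /\ p = \sum_(t <- s) t.1 * t.2.

Lemma ideal_span0 : ideal_span 0.
Proof. by exists [::]; rewrite big_nil. Qed.

Lemma ideal_spanD p q : ideal_span p -> ideal_span q -> ideal_span (p + q).
Proof.
move=> [s [sF ->]] [t [tF ->]]; exists (s ++ t); split; last by rewrite big_cat.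
by move=> x; rewrite mem_cat => /orP[/sF|/tF].
Qed.

Lemma ideal_spanM c p : ideal_span p -> ideal_span (c * p).
Proof.
move=> [s [sF ->]]; exists [seq (c * t.1, t.2) | t <- s]; split.
  by move=> _ /mapP[t /sF tF ->].
by rewrite big_map mulr_sumr; apply: eq_bigr => t _; rewrite mulrA.
Qed.

End IdealSpan.

(* A line of P^n is given by the 2-dimensional subspace of K^(n+1) that is the
   affine cone over it. *)
Record line (K : fieldType) (n : nat) := Line {
  cone :> {vspace 'rV[K]_n.+1};
  dim_cone : \dim cone = 2%N
}.

Section CoordinateRing.
Variables (K : fieldType) (n : nat).
Local Notation S := {mpoly K[n.+1]}.

Definition vanishing_form (L : line K n) (f : S) : Prop :=
  (exists d, f \is d.-homog) /\
  (forall v : 'rV[K]_n.+1, v \in cone L -> f.@[fun j => v 0 j] = 0).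

Definition line_ideal (L : line K n) : S -> Prop :=
  ideal_span (vanishing_form L).

Variables (m : nat) (M : 'I_m -> line K n).

Definition lines_ideal : {pred S} :=
  fun p => `[< forall i, line_ideal (M i) p >].

Lemma lines_ideal_zmod_closed : zmod_closed lines_ideal.
Proof.
split; first by apply/asboolP => i; exact: ideal_span0.
move=> p q /asboolP Mp /asboolP Mq; apply/asboolP => i.
by rewrite -mulN1r; apply: ideal_spanD (Mp i) (ideal_spanM _ (Mq i)).
Qed.

HB.instance Definition _ :=
  GRing.isZmodClosed.Build S lines_ideal lines_ideal_zmod_closed.

Lemma lines_idealM c p : p \in lines_ideal -> c * p \in lines_ideal.
Proof.
by move=> /asboolP Mp; apply/asboolP => i; exact: ideal_spanM _ (Mp i).
Qed.

(* [{ideal_quot _}] has a ring structure in the library only for a proper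
   ideal; here m = 0 is allowed, in which case the quotient is the zero ring. *)
Definition coordinate_ring := {ideal_quot lines_ideal}.

HB.instance Definition _ := GRing.Zmodule.on coordinate_ring.
HB.instance Definition _ := EqQuotient.on coordinate_ring.

Local Notation R := coordinate_ring.

Definition coordinate_one : R := \pi_R 1.
Definition coordinate_mul (x y : R) : R := \pi_R (repr x * repr y).

Lemma coordinate_pi_mul p q :
  coordinate_mul (\pi_R p) (\pi_R q) = \pi_R (p * q).
Proof.
have reprB (r : S) : repr (\pi_R r) - r \in lines_ideal.
  by rewrite Quotient.idealrBE reprK.
apply/eqP; rewrite -Quotient.idealrBE.
set p' := repr _; set q' := repr _.
have -> : p' * q' - p * q = q' * (p' - p) + p * (q' - q).
  by rewrite !mulrBr [q' * p']mulrC [q' * p]mulrC addrA subrK.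
by rewrite rpredD //; apply: lines_idealM; exact: reprB.
Qed.

Lemma coordinate_mulA : associative coordinate_mul.
Proof.
elim/quotW=> p; elim/quotW=> q; elim/quotW=> r.
rewrite (coordinate_pi_mul q r) (coordinate_pi_mul p q).
by rewrite (coordinate_pi_mul p) (coordinate_pi_mul (p * q)) mulrA.
Qed.

Lemma coordinate_mulC : commutative coordinate_mul.
Proof. by move=> x y; rewrite /coordinate_mul mulrC. Qed.

Lemma coordinate_mul1 : left_id coordinate_one coordinate_mul.
Proof.
by elim/quotW=> p; rewrite (coordinate_pi_mul 1) mul1r.
Qed.

Lemma coordinate_mulDl : left_distributive coordinate_mul +%R.
Proof.
elim/quotW=> p; elim/quotW=> q; elim/quotW=> r.
have piD (s t : S) : \pi_R s + \pi_R t = \pi_R (s + t) by rewrite !piE.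
rewrite piD (coordinate_pi_mul (p + q)) (coordinate_pi_mul p).
by rewrite (coordinate_pi_mul q) piD mulrDl.
Qed.

HB.instance Definition _ := GRing.Zmodule_isComPzRing.Build coordinate_ring
  coordinate_mulA coordinate_mulC coordinate_mul1 coordinate_mulDl.

Definition coordinate_grading (d : nat) (x : R) : Prop :=
  exists2 p : S, p \is d.-homog & x = \pi_R p.

End CoordinateRing.

Arguments coordinate_grading {K n m} M d x.

Section Koszul.
Variables (A : comPzRingType) (gr : nat -> A -> Prop).

Definition irrelevant_ideal (x : A) : Prop :=
  exists (N : nat) (f : nat -> A),
    (forall d, gr d (f d)) /\ x = \sum_(1 <= d < N) f d.

(* A linear free resolution over A of A/m, m the irrelevant ideal:
     ... -> A(-2)^(b 2) -> A(-1)^(b 1) -> A^(b 0) -> A/m -> 0,   b = res_rank.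
   Free modules consist of row vectors and maps act by right multiplication;
   a degree 0 map from A(-i-1)^r to A(-i)^s is a matrix with entries in A_1.
   The augmentation is the map induced by res_aug followed by A -> A/m. *)
Record linear_resolution := LinearResolution {
  res_rank : nat -> nat;
  res_aug : 'cV[A]_(res_rank 0);
  res_diff : forall i, 'M[A]_(res_rank i.+1, res_rank i);
  res_aug_homog : forall k, gr 0 (res_aug k 0);
  res_diff_homog : forall i k l, gr 1 (res_diff i k l);
  res_aug_surj : exists u : 'rV[A]_(res_rank 0),
    irrelevant_ideal ((u *m res_aug) 0 0 - 1);
  res_aug_exact : forall u : 'rV[A]_(res_rank 0),
    irrelevant_ideal ((u *m res_aug) 0 0) <-> exists w, u = w *m res_diff 0;
  res_diff_exact : forall i (u : 'rV[A]_(res_rank i.+1)),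
    u *m res_diff i = 0 <-> exists w, u = w *m res_diff i.+1
}.

Definition Koszul : Prop := inhabited linear_resolution.

End Koszul.

Definition alg_independent_over_rat (K : fieldType) (I : finType) (a : I -> K) :
    Prop :=
  forall p : {mpoly rat[#|I|]},
    p != 0 -> mmap (@ratr K) (fun k => a (enum_val k)) p != 0.

Definition linear_form (K : fieldType) (N : nat) (a : 'rV[K]_N) :
    {mpoly K[N]} := \sum_(j < N) a 0 j *: 'X_j.

Definition generic_lines (K : fieldType) (n m : nat) (M : 'I_m -> line K n) :
    Prop :=
  exists a : 'I_m -> 'M[K]_(n.-1, n.+1),
    alg_independent_over_rat
      (fun t : 'I_m * 'I_n.-1 * 'I_n.+1 => a t.1.1 t.1.2 t.2) /\
    (forall i p, line_ideal (M i) p <->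
       ideal_span (fun f => exists k, f = linear_form (row k (a i))) p).

(* Main.v *)
Require Import Defs.
From HB Require Import structures.
From mathcomp Require Import all_boot all_order all_algebra.
From mathcomp Require Import boolp reals complex mpoly.
From mathcomp Require Import ring lra zify.

(* Write h(d) for the Hilbert function of the coordinate ring of the m lines.
   The conditions imposed on quadrics by m generic lines are independent as long
   as 3m <= C(n+2, 2), and otherwise no quadric contains the lines. By
   genericity it is enough to have one configuration of rational lines with this
   property; it is built by adding three variables at a time.

   If no quadric contains the lines, let f be a form of least degree in the
   ideal. In degrees below deg f the ring is a polynomial ring, so a linear
   resolution lifts there and expresses f through products of consecutive
   differentials, which vanish: f = 0.

   Otherwise independence in degree 2 propagates to all higher degrees (multiply
   by linear forms), so h(0) = 1, h(1) = n+1 and h(d) = m(d+1) for d >= 2. The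
   linear strands of a linear resolution with ranks b(i) give
   sum_i (-1)^i b(i) h(d-i) = 0 for d >= 1, that is, b satisfies the linear
   recurrence with characteristic polynomial
     x^3 - (n-1) x^2 + (3m-2n-1) x + (2m-n-1).
   The bound on m says that its discriminant is negative, so that its only real
   root is negative; a recurrent sequence of this kind cannot stay
   nonnegative. *)

Set Implicit Arguments.
Unset Strict Implicit.
Unset Printing Implicit Defensive.

Import Order.TTheory GRing.Theory Num.Theory.
Local Open Scope ring_scope.
Local Open Scope complex_scope.
Local Open Scope quotient_scope.

(** * Nonnegative recurrent sequences *)

(* The ratios [c d.+1 / c d] would decrease by at least a fixed positive
   amount at each step. *)
Lemma quadratic_recurrence_sign (R : realType) (p q : R) (c : nat -> R) :
    p ^+ 2 < 4 * q -> (forall d, 0 <= c d) -> 0 < c 0%N ->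
  (forall d, c d.+2 = p * c d.+1 - q * c d) -> False.
Proof.
move=> pq c0 c00 rec.
have q0 : 0 < q by have := sqr_ge0 p; lra.
(* If [c d] is positive and [c d.+1] is zero, then [c d.+2] equals [- q * c d], which is
   negative. *)
have cp d : 0 < c d.
  elim: d => // d IH; rewrite lt_neqAle c0 andbT eq_sym; apply/eqP => cd.
  have := c0 d.+2; rewrite rec cd mulr0 sub0r oppr_ge0 leNgt.
  by rewrite mulr_gt0.
(* [e] is the minimum of [x ^+ 2 - p * x + q]; completing the square shows that each ratio drops by
   at least [e / t d], hence by at least [e / t 0]. *)
pose e := q - p ^+ 2 / 4; have e0 : 0 < e by rewrite /e; lra.
pose t d := c d.+1 / c d.
have t0 d : 0 < t d by rewrite divr_gt0.
have tS d : t d.+1 = p - q / t d.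
  rewrite /t rec; field; by rewrite !gt_eqF.
have dec d : t d.+1 <= t d - e / t d.
  have -> : t d - e / t d = t d.+1 + (t d - p / 2) ^+ 2 / t d.
    by rewrite tS /e; field; rewrite gt_eqF.
  by rewrite lerDl divr_ge0 ?sqr_ge0 // ltW.
have tle d : t d <= t 0%N.
  elim: d => // d IH; apply: le_trans IH; apply: le_trans (dec d) _.
  by rewrite gerBl divr_ge0 // ltW.
have tlin d : t d <= t 0%N - d%:R * (e / t 0%N).
  elim: d => [|d IH]; first by rewrite mul0r subr0.
  apply: le_trans (dec d) _;
  have -> : t 0%N - d.+1%:R * (e / t 0%N) =
      t 0%N - d%:R * (e / t 0%N) - e / t 0%N by rewrite -natr1; ring.
  apply: lerB => //; apply: ler_wpM2l; first exact: ltW.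
  by rewrite lef_pV2 ?posrE.
pose N := Num.bound (t 0%N / (e / t 0%N)).
have h : t 0%N / (e / t 0%N) < N%:R.
  by apply: archi_boundP; rewrite !divr_ge0 // ltW.
move: h; rewrite ltr_pdivrMr ?divr_gt0 // => h.
by have := tlin N; have := t0 N; lra.
Qed.

(** Here [- r] is a negative root of x^3 - a x^2 + b x + c, found by the intermediate value theorem
    after the change of sign x = -r. *)
Lemma cubic_neg_root (R : realType) (a b c : R) : 0 < c ->
  exists2 r, 0 < r & r ^+ 3 + a * r ^+ 2 + b * r = c.
Proof.
move=> c0.
pose P : {poly R} := 'X^3 + a *: 'X^2 + b *: 'X - c%:P.
have PE x : P.[x] = x ^+ 3 + a * x ^+ 2 + b * x - c.
  by rewrite /P !hornerE.
(* Large enough for the cubic term to dominate, so that [P] is nonnegative at [B]. *)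
pose B := 1 + `|a| + `|b| + c.
have ha := ler_norm (- a); have hb := ler_norm (- b).
rewrite !normrN in ha hb.
have na := normr_ge0 a; have nb := normr_ge0 b.
have B1 : 1 <= B by rewrite /B; lra.
have [x /andP[x0 xB] /eqP] : exists2 x, 0 <= x <= B & root P x.
  apply: poly_ivt; first by apply: le_trans B1.
  rewrite !PE; apply/andP; split; first by nra.
  have h1 : B <= B ^+ 2 by nra.
  have h2 : 0 <= B ^+ 2 * (B + a - 1 - `|b| - c).
    by rewrite mulr_ge0 ?sqr_ge0 // /B; lra.
  have h3 : 0 <= (B ^+ 2 - B) * `|b| by rewrite mulr_ge0 //; lra.
  have h4 : 0 <= B * (b + `|b|) by rewrite mulr_ge0 //; lra.
  have h5 : 0 <= (B ^+ 2 - 1) * c by rewrite mulr_ge0 //; lra.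
  have -> : B ^+ 3 + a * B ^+ 2 + b * B - c =
     B ^+ 2 * (B + a - 1 - `|b| - c) + (B ^+ 2 - B) * `|b|
     + B * (b + `|b|) + (B ^+ 2 - 1) * c + B ^+ 2 by ring.
  by have := sqr_ge0 B; lra.
rewrite PE => xr; exists x; last by lra.
rewrite lt_neqAle x0 andbT; apply/eqP => xE.
by move: xr; rewrite -xE !expr0n !mulr0 !addr0 sub0r; lra.
Qed.

(* The left-hand side of the second hypothesis is the discriminant of
   [x^3 - a x^2 + b x + c]: this cubic has a single real root, which is
   negative. *)
Lemma cubic_recurrence_sign (R : realType) (a b c : R) (s : nat -> R) :
    0 < c ->
    a ^+ 2 * b ^+ 2 - 4 * b ^+ 3 + 4 * a ^+ 3 * c - 27 * c ^+ 2
      - 18 * a * b * c < 0 ->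
    (forall d, 0 <= s d) -> 0 < s 0%N ->
    (forall d, s d.+3 - a * s d.+2 + b * s d.+1 + c * s d = 0) ->
  False.
Proof.
move=> c0 disc s0 s00 rec.
have [r r0 rE] := cubic_neg_root a b c0.
(* The cubic factors as (x + r)(x^2 - p x + q). Its discriminant is that of the quadratic factor
   times the square of the value of this factor at -r. *)
pose p := a + r; pose q := r ^+ 2 + a * r + b.
have pq : p ^+ 2 < 4 * q.
  rewrite ltNge; apply/negP => h; move: disc; rewrite ltNge => /negP; apply.
  have -> : a ^+ 2 * b ^+ 2 - 4 * b ^+ 3 + 4 * a ^+ 3 * c - 27 * c ^+ 2
      - 18 * a * b * c = (p ^+ 2 - 4 * q) * (r ^+ 2 + p * r + q) ^+ 2.
    by rewrite /p /q -rE; ring.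
  by rewrite mulr_ge0 ?sqr_ge0 // subr_ge0.
(* Applying the factor x + r to the recurrence leaves a sequence governed by the quadratic factor,
   still nonnegative because r is positive. *)
apply: (@quadratic_recurrence_sign R p q (fun d => s d.+1 + r * s d)) => //.
- by move=> d; rewrite addr_ge0 ?mulr_ge0 // ltW.
- by rewrite ltr_wpDl ?mulr_gt0.
- move=> d; have := rec d; rewrite /p /q -rE => h; apply/eqP.
  by rewrite -subr_eq0 -[X in _ == X]h; apply/eqP; ring.
Qed.

Lemma lines_recurrence_sign (R : realType) (n m : nat) (s : nat -> R) :
    (3 <= n)%N ->
    m%:R > 72%:R^-1 *
            (3%:R * (n%:R ^+ 2 + 10%:R * n%:R + 13%:R) +
             Num.sqrt (3%:R * (n%:R - 1) ^+ 3 * (3%:R * n%:R + 5%:R))) :> R ->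
    (forall d, 0 <= s d) -> 0 < s 0%N ->
    (forall d, s d.+3 - (n%:R - 1) * s d.+2
       + (3 * m%:R - 2 * n%:R - 1) * s d.+1 + (2 * m%:R - n%:R - 1) * s d = 0) ->
  False.
Proof.
move=> n3 hm s0 s00 rec.
have hn : 3 <= n%:R :> R by rewrite (ler_nat R 3).
move: hm rec; move: n%:R m%:R hn => x y hx hy rec.
pose B := 3%:R * (x - 1) ^+ 3 * (3%:R * x + 5%:R).
have B0 : 0 <= B by rewrite /B !mulr_ge0 ?exprn_ge0 //; lra.
have S0 := sqrtr_ge0 B; have SE := sqr_sqrtr B0.
rewrite -/B in hy; move: (Num.sqrt B) S0 SE hy => S S0 SE hy.
pose A := x ^+ 2 + 10%:R * x + 13%:R.
have hyA : 72%:R * y > 3%:R * A + S by rewrite /A; lra.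
have A0 : 0 <= A by rewrite /A; nra.
have y0 : 0 < y by lra.
apply: cubic_recurrence_sign s0 s00 rec.
  by move: hyA; rewrite /A; nra.
(* Up to the factor [- y / 48], the discriminant is a quadratic polynomial in [y] whose larger root
   is the bound on m. *)
have discE : forall a b c, a = x - 1 -> b = 3 * y - 2 * x - 1 ->
   c = 2 * y - x - 1 -> a ^+ 2 * b ^+ 2 - 4 * b ^+ 3 + 4 * a ^+ 3 * c
  - 27 * c ^+ 2 - 18 * a * b * c =
  - (y * ((72%:R * y - 3%:R * A) ^+ 2 - B) / 48).
  by move=> a b c -> -> ->; rewrite /A /B; field.
rewrite (discE _ _ _ erefl erefl erefl).
rewrite oppr_lt0 divr_gt0 // mulr_gt0 // -SE.
have -> : (72%:R * y - 3%:R * A) ^+ 2 - S ^+ 2 =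
  (72%:R * y - 3%:R * A - S) * (72%:R * y - 3%:R * A + S) by ring.
by rewrite mulr_gt0 //; lra.
Qed.

(** * Alternating sums along the linear strands of a resolution *)

Section StrandRecurrence.
Variables (R : realFieldType) (b h : nat -> nat) (rho : nat -> nat -> nat).
Hypotheses (rhoSS : forall d i, (rho d.+1 i + rho d i.+1 = b i.+1 * h d.+1)%N)
  (rho0 : forall i, rho 0%N i = (b i.+1 * h 0)%N)
  (rho_0 : forall d, rho d 0%N = (b 0 * h d.+1)%N).

(** Each term of the strand is the sum of the ranks of its incoming and outgoing maps, so the
    alternating sum telescopes to the rank of the map into position [j]. *)
Lemma strand_partial_euler d j : (j <= d)%N ->
  \sum_(i < j.+1) (-1) ^+ i * (b i * h (d.+1 - i))%:R =
  (-1) ^+ j * (rho (d - j) j)%:R :> R.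
Proof.
elim: j => [|j IH] jd; first by rewrite big_ord1 !subn0 rho_0.
rewrite big_ord_recr /= IH 1?ltnW //.
have -> : (d.+1 - j.+1 = (d - j.+1).+1)%N by lia.
rewrite -rhoSS; have -> : (d - j = (d - j.+1).+1)%N by lia.
by rewrite natrD exprS; ring.
Qed.

(** This is the vanishing, in positive degree, of the coefficients of the product of the generating
    series of [b i] and of [(-1) ^+ j * h j]. *)
Lemma strand_euler d :
  \sum_(i < d.+2) (b i)%:R * ((-1) ^+ (d.+1 - i) * (h (d.+1 - i))%:R) = 0 :> R.
Proof.
transitivity ((-1) ^+ d.+1 *
    \sum_(i < d.+2) (-1) ^+ i * (b i * h (d.+1 - i))%:R : R).
  rewrite mulr_sumr; apply: eq_bigr => i _; rewrite natrM.
  have id : (i <= d.+1)%N by rewrite -ltnS.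
  have -> : (-1) ^+ d.+1 = (-1) ^+ (d.+1 - i) * (-1) ^+ i :> R.
    by rewrite -exprD subnK.
  have := sqrr_sign R i; move: ((-1) ^+ i) => x xx.
  by rewrite mulrCA -[LHS]mul1r -xx; ring.
rewrite big_ord_recr /= strand_partial_euler // !subnn rho0 exprS.
by ring.
Qed.

Lemma strand_recurrence (n m : nat) :
  h 0 = 1%N -> h 1 = n.+1 -> (forall d, h d.+2 = (m * d.+3)%N) ->
  forall e, (b e.+3)%:R - (n%:R - 1) * (b e.+2)%:R
    + (3 * m%:R - 2 * n%:R - 1) * (b e.+1)%:R
    + (2 * m%:R - n%:R - 1) * (b e)%:R = 0 :> R.
Proof.
move=> h0 h1 h2 e.
(* From degree 2 on, [k j] is (-1)^j m (j + 1), which is annihilated by the square of 1 + shift;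
   hence the weights 1, 2, 1 below. *)
pose k j : R := (-1) ^+ j * (h j)%:R.
have k3 j : k j.+4 + 2 * k j.+3 + k j.+2 = 0.
  by rewrite /k !h2 !exprS !natrM -[j.+3%:R]natr1 -[j.+4%:R]natr1 -[j.+4.+1%:R]natr1
    -[j.+4%:R]natr1 -[j.+3%:R]natr1; ring.
have E d : \sum_(i < d.+2) (b i)%:R * k (d.+1 - i)%N = 0 := strand_euler d.
have := E e.+2; have := E e.+1; have := E e; rewrite !big_ord_recr /=.
(* The terms with [i < e] involve [k] only at indices at least 2, so they cancel in the weighted sum
   of three consecutive identities; only the four values from [b e] to [b e.+3] remain. *)
pose T c := \sum_(i < e) (b i)%:R * k (c - i)%N.
have k30 : T e.+3 + 2 * T e.+2 + T e.+1 = 0.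
  rewrite /T mulr_sumr -!big_split big1 //= => i _.
  have [j je] : exists j, e = (i + j.+1)%N.
    by exists (e - i).-1; have := ltn_ord i; lia.
  have -> : (e.+3 - i = j.+4)%N by move: je; clear; lia.
  have -> : (e.+2 - i = j.+3)%N by move: je; clear; lia.
  have -> : (e.+1 - i = j.+2)%N by move: je; clear; lia.
  by rewrite -(mulr0 (b i)%:R) -(k3 j); ring.
have -> : (e.+3 - e.+2 = 1)%N by clear; lia.
rewrite !subnn.
have -> : (e.+3 - e.+1 = 2)%N by clear; lia.
have -> : (e.+3 - e = 3)%N by clear; lia.
have -> : (e.+2 - e.+1 = 1)%N by clear; lia.
have -> : (e.+2 - e = 2)%N by clear; lia.
have -> : (e.+1 - e = 1)%N by clear; lia.
have kE0 : k 0%N = 1 by rewrite /k h0 mul1r.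
have kE1 : k 1%N = - (n%:R + 1) by rewrite /k h1 mulN1r natr1.
have kE2 : k 2%N = 3 * m%:R by rewrite /k h2 sqrrN expr1n natrM; ring.
have kE3 : k 3%N = - (4 * m%:R) by rewrite /k h2 !exprS expr0 natrM; ring.
rewrite -/(T e.+1) -/(T e.+2) -/(T e.+3) kE0 kE1 kE2 kE3.
move: (T e.+3) (T e.+2) (T e.+1) k30 => T3 T2 T1 k30 E1 E2 E3.
move: (b e.+3)%:R (b e.+2)%:R (b e.+1)%:R (b e)%:R n%:R m%:R E1 E2 E3.
move=> b3 b2 b1 b0 x y E1 E2 E3;  by clear -k30 E1 E2 E3; lra.
Qed.

End StrandRecurrence.

(** * A special configuration of lines *)

Section Configuration.
Variable V : zmodType.
Implicit Types (q : V -> V -> rat) (L : seq (V * V)) (P : seq V).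

Definition symmetric_biadditive q :=
  (forall x y, q x y = q y x) /\ (forall x y z, q (x + y) z = q x z + q y z).

(** The line joining the points [t.1] and [t.2] lies on the quadric of [q]. *)
Definition isotropic q (t : V * V) :=
  [/\ q t.1 t.1 = 0, q t.1 t.2 = 0 & q t.2 t.2 = 0].

Definition all_isotropic q L := forall t, t \in L -> isotropic q t.

Lemma all_isotropic_cons q t L :
  all_isotropic q (t :: L) <-> isotropic q t /\ all_isotropic q L.
Proof.
split=> [h|[h1 h2] x]; last by rewrite inE => /orP[/eqP->|/h2].
by split=> [|x xL]; apply: h; rewrite inE ?eqxx ?xL ?orbT.
Qed.

Lemma all_isotropic_cat q L1 L2 :
  all_isotropic q (L1 ++ L2) <-> all_isotropic q L1 /\ all_isotropic q L2.
Proof.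
elim: L1 => [|t L1 IH] /=; first by split=> [|[]].
by rewrite !all_isotropic_cons IH; tauto.
Qed.

Definition null_on q (B : seq V) := forall x y, x \in B -> y \in B -> q x y = 0.

Lemma null_on_cat q B C : (forall x y, q x y = q y x) ->
  null_on q B -> null_on q C -> (forall x y, x \in B -> y \in C -> q x y = 0) ->
  null_on q (B ++ C).
Proof.
move=> qC qB qM qBM x y; rewrite !mem_cat.
move=> /orP[xB|xM] /orP[yB|yM]; [exact: qB|exact: qBM| |exact: qM].
by rewrite qC; exact: qBM.
Qed.

(** Once [q] is null on [B], the unknown values are those between [B] and the new vectors and those
    among the new vectors, 3 |B| + 6 in number. A line gives three equations, so |B| + 2 lines is
    the exact count. *)
Definition extends_null (B : seq V) (f : V * V * V) :=
  let: (f1, f2, f3) := f in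
  exists2 L, size L = (size B).+2 & forall q, symmetric_biadditive q ->
    null_on q B -> all_isotropic q L -> null_on q (B ++ [:: f1; f2; f3]).

Lemma extends_null1 g f : extends_null [:: g] f.
Proof.
case: f => [[f1 f2] f3].
exists [:: (f1, f3); (g + f1, f2); (g + f3, g + f2)] => // q [qC qA] gB.
have qAr x y z : q x (y + z) = q x y + q x z by rewrite qC qA !(qC _ x).
have gg : q g g = 0 by apply: gB; rewrite inE.
move=> /all_isotropic_cons[[/= a1 a2 a3]].
move=> /all_isotropic_cons[[/= b1 b2 b3]].
move=> /all_isotropic_cons[[/= c1 c2 c3]] _.
rewrite !(qA, qAr) in a1 a2 a3 b1 b2 b3 c1 c2 c3.
have := (qC f1 g, qC f2 g, qC f3 g, qC f2 f1, qC f3 f1, qC f3 f2).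
move=> [[[[[s1 s2] s3] s4] s5] s6] x y /=.
by rewrite !inE; do ![case/orP]=> /eqP-> ; do ![case/orP]=> /eqP->; lra.
Qed.

Lemma extends_null2 g1 g2 f : extends_null [:: g1; g2] f.
Proof.
case: f => [[f1 f2] f3].
exists [:: (f1, f3); (g1 + f1, g2 + f2); (g2 + f3, g1 + f2);
  (g1 + (f2 + f3), g2 + (f1 + (f2 + f3)))] => // q [qC qA] gB.
have qAr x y z : q x (y + z) = q x y + q x z by rewrite qC qA !(qC _ x).
have g11 : q g1 g1 = 0 by apply: gB; rewrite !inE eqxx.
have g12 : q g1 g2 = 0 by apply: gB; rewrite !inE eqxx ?orbT.
have g22 : q g2 g2 = 0 by apply: gB; rewrite !inE eqxx ?orbT.
move=> /all_isotropic_cons[[/= a1 a2 a3]].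
move=> /all_isotropic_cons[[/= b1 b2 b3]].
move=> /all_isotropic_cons[[/= c1 c2 c3]].
move=> /all_isotropic_cons[[/= d1 d2 d3]] _.
rewrite !(qA, qAr) in a1 a2 a3 b1 b2 b3 c1 c2 c3 d1 d2 d3.
have := (qC f1 g1, qC f2 g1, qC f3 g1, qC f1 g2, qC f2 g2, qC f3 g2).
move=> [[[[[s1 s2] s3] s4] s5] s6].
have := (qC f2 f1, qC f3 f1, qC f3 f2, qC g2 g1).
move=> [[[s7 s8] s9] s10] x y /=.
by rewrite !inE; do ![case/orP]=> /eqP-> ; do ![case/orP]=> /eqP->; lra.
Qed.

(** The lines obtained for [B] leave only the six values of [q] between [g1], [g2] and the new
    vectors; the two additional lines kill these. *)
Lemma extends_null_add2 g1 g2 B f :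
  extends_null B f -> extends_null [:: g1, g2 & B] f.
Proof.
case: f => [[f1 f2] f3] [L sL LP].
exists [:: (g1 + f1, g2 + f3), (g1 + f2, g2 + f1) & L] => [|q qS gB] /=.
  by rewrite sL.
move=> /all_isotropic_cons[[/= a1 a2 a3]].
move=> /all_isotropic_cons[[/= b1 b2 b3]] qL.
have [qC qA] := qS.
have qAr x y z : q x (y + z) = q x y + q x z by rewrite qC qA !(qC _ x).
rewrite !(qA, qAr) in a1 a2 a3 b1 b2 b3.
have BP : null_on q B.
  by move=> x y xB yB; apply: gB; rewrite !inE ?xB ?yB !orbT.
have nf := LP _ qS BP qL.
have fF x : x \in [:: f1; f2; f3] -> x \in B ++ [:: f1; f2; f3].
  by rewrite mem_cat => ->; rewrite orbT.
have f11 : q f1 f1 = 0 by apply: nf; apply: fF; rewrite !inE eqxx ?orbT.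
have f12 : q f1 f2 = 0 by apply: nf; apply: fF; rewrite !inE eqxx ?orbT.
have f13 : q f1 f3 = 0 by apply: nf; apply: fF; rewrite !inE eqxx ?orbT.
have f22 : q f2 f2 = 0 by apply: nf; apply: fF; rewrite !inE eqxx ?orbT.
have f33 : q f3 f3 = 0 by apply: nf; apply: fF; rewrite !inE eqxx ?orbT.
have g11 : q g1 g1 = 0 by apply: gB; rewrite !inE eqxx.
have g12 : q g1 g2 = 0 by apply: gB; rewrite !inE eqxx ?orbT.
have g22 : q g2 g2 = 0 by apply: gB; rewrite !inE eqxx ?orbT.
have := (qC f1 g1, qC f2 g1, qC f3 g1, qC f1 g2, qC f2 g2, qC f3 g2).
move=> [[[[[s1 s2] s3] s4] s5] s6].
have := (qC f2 f1, qC f3 f1, qC f3 f2, qC g2 g1).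
move=> [[[s7 s8] s9] s10].
have gf x y : x \in [:: g1; g2] -> y \in [:: f1; f2; f3] -> q x y = 0.
  by rewrite !inE; do ![case/orP]=> /eqP-> ; do ![case/orP]=> /eqP->; lra.
apply: (@null_on_cat q [:: g1, g2 & B]) => //.
  by move=> x y xB yB; apply: nf; apply: fF.
move=> x y; rewrite inE => /orP[xg|]; first by apply: gf; rewrite inE xg.
rewrite inE => /orP[xg|xB yf]; first by apply: gf; rewrite !inE xg orbT.
by apply: nf; rewrite mem_cat ?xB ?yf ?orbT.
Qed.

Lemma extends_null_all B f : B != [::] -> extends_null B f.
Proof.
have [k] := ubnP (size B); elim: k B => // k IH [|g1 [|g2 [|g3 B]]] // kB _.
- exact: extends_null1.
- exact: extends_null2.
- by apply: extends_null_add2; apply: IH => //; move: kB => /=; lia.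
Qed.

(* [L] and [P] impose independent conditions on the quadrics of the span of
   [B], and no such quadric satisfies them all. *)
Definition null_configuration (B : seq V) :=
  exists L P, [/\ (3 * size L + size P = (size B * (size B).+1)./2)%N,
    (size P <= 1)%N & forall q, symmetric_biadditive q ->
      all_isotropic q L -> (forall p, p \in P -> q p p = 0) -> null_on q B].

(** The counts match: k(k+1)/2 grows by 3(k+2) when k grows by 3, which is the number of conditions
    given by the k + 2 lines of [extends_null]. *)
Lemma null_configuration_add3 B f1 f2 f3 : B != [::] ->
  null_configuration B -> null_configuration (B ++ [:: f1; f2; f3]).
Proof.
move=> B0 [L [P [sLP sP LP]]].
have [L' sL' LP'] := extends_null_all (f1, f2, f3) B0.
exists (L ++ L'), P; split => // [|q qS].
  rewrite !size_cat mulnDr sL' addnAC sLP /=.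
  have -> : ((size B + 3) * (size B + 3).+1 =
    size B * (size B).+1 + (3 * (size B).+2).*2)%N by lia.
  by rewrite halfD odd_double andbF doubleK.
by move=> /all_isotropic_cat[qL qL'] qP; apply: LP' => //; exact: LP.
Qed.

Lemma null_configuration1 g : null_configuration [:: g].
Proof.
exists [::], [:: g]; split => // q _ _ qP x y; rewrite !inE => /eqP-> /eqP->.
by apply: qP; rewrite inE.
Qed.

Lemma null_configuration2 g1 g2 : null_configuration [:: g1; g2].
Proof.
exists [:: (g1, g2)], [::]; split => // q [qC _].
move=> /all_isotropic_cons[[/= a1 a2 a3]] _ _ x y; rewrite !inE.
by move=> /orP[]/eqP-> /orP[]/eqP->; rewrite // qC.
Qed.

(* Not obtained from three vectors: any two planes of a 3-dimensional space
   meet. *)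
Lemma null_configuration6 e0 e1 e2 e3 e4 e5 :
  null_configuration [:: e0; e1; e2; e3; e4; e5].
Proof.
exists [:: (e0, e1); (e2, e3); (e4, e5); (e2 + e5, e4 + e1);
  (e0 + e5, e3 + e4); (e3 + e5, e1 + e5); (e5 + (e0 + e3), e2 + e1)], [::].
split => // q [qC qA].
have qAr x y z : q x (y + z) = q x y + q x z by rewrite qC qA !(qC _ x).
move=> /all_isotropic_cons[[/= a1 a2 a3]].
move=> /all_isotropic_cons[[/= b1 b2 b3]].
move=> /all_isotropic_cons[[/= c1 c2 c3]].
move=> /all_isotropic_cons[[/= d1 d2 d3]].
move=> /all_isotropic_cons[[/= h1 h2 h3]].
move=> /all_isotropic_cons[[/= i1 i2 i3]].
move=> /all_isotropic_cons[[/= j1 j2 j3]] _ _.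
rewrite !(qA, qAr) !(qC e1 e0, qC e2 e0, qC e3 e0, qC e4 e0, qC e5 e0, qC e2 e1,
  qC e3 e1, qC e4 e1, qC e5 e1, qC e3 e2, qC e4 e2, qC e5 e2, qC e4 e3,
  qC e5 e3, qC e5 e4) in a1 a2 a3 b1 b2 b3 c1 c2 c3 d1 d2 d3 h1 h2 h3
  i1 i2 i3 j1 j2 j3.
move=> x y; rewrite !inE; do ![case/orP]=> /eqP->; do ![case/orP]=> /eqP->;
  rewrite ?(qC e1 e0, qC e2 e0, qC e3 e0, qC e4 e0, qC e5 e0, qC e2 e1,
  qC e3 e1, qC e4 e1, qC e5 e1, qC e3 e2, qC e4 e2, qC e5 e2, qC e4 e3,
  qC e5 e3, qC e5 e4); lra.
Qed.

Lemma null_configuration_exists B :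
  B != [::] -> size B != 3 -> null_configuration B.
Proof.
have [k] := ubnP (size B); elim: k B => // k IH B kB B0 B3.
have [B4|] := ltnP 3 (size B); last first.
  case: B B0 B3 {kB} => [|g1 [|g2 [|g3 [|? ?]]]] // _ _ _.
    exact: null_configuration1.
  exact: null_configuration2.
(* Removing three vectors from six would leave the excluded size 3, so six is a base case along with
   one and two. *)
have [B6|B6] := eqVneq (size B) 6.
  by case: B B6 {kB B0 B3 B4} => [|a [|b [|c [|d [|e [|f [|? ?]]]]]]] // _;
    exact: null_configuration6.
have sD : size (drop (size B - 3) B) = 3 by rewrite size_drop; lia.
have sT : size (take (size B - 3) B) = (size B - 3)%N by rewrite size_takel; lia.
have -> : B = take (size B - 3) B ++ drop (size B - 3) B by rewrite cat_take_drop.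
move: (drop _ _) (take _ _) sD sT => [|f1 [|f2 [|f3 [|? ?]]]] // T _ sT.
have T0 : T != [::] by rewrite -size_eq0 sT; lia.
by apply: null_configuration_add3 => //; apply: IH => //; rewrite sT; lia.
Qed.

End Configuration.

(** * Specialization of generic lines *)

(** With [C] and [D] fixed, the rank is certified by the nonvanishing of a single determinant, which
    can be carried from one specialization to another. *)
Lemma mxrank_factor1 (F : fieldType) p q (E : 'M[F]_(p, q)) :
  exists C D, C *m E *m D = 1%:M :> 'M_(\rank E).
Proof.
exists (pid_mx (\rank E) *m invmx (col_ebase E)).
exists (invmx (row_ebase E) *m pid_mx (\rank E)).
rewrite -[X in _ *m X *m _](mulmx_ebase E) !mulmxA.
rewrite mulmxKV ?col_ebase_unit // mulmxK ?row_ebase_unit //.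
rewrite !mul_pid_mx -pid_mx_1; congr pid_mx.
by have := rank_leq_row E; have := rank_leq_col E; lia.
Qed.

Lemma mxrank_of_det (F : fieldType) p q r (E : 'M[F]_(p, q)) C D :
  \det (C *m E *m D : 'M_r) != 0 -> (r <= \rank E)%N.
Proof.
rewrite -unitfE -/(_ \in unitmx) => /mxrank_unit rE.
rewrite -{1}rE; apply: leq_trans (mxrankM_maxl _ _) _; exact: mxrankM_maxr.
Qed.

Section KernelMx.
Variable k : nat.

(** The first two rows are solutions of the equations [a], because the adjugate times the matrix is
    scalar. An adjugate is polynomial in the entries, so it makes sense over a polynomial ring and
    commutes with ring morphisms; [c] is an auxiliary completion to a square matrix. *)
Definition kernel_mx (A : comNzRingType) (c : 'M[A]_(k.+2, 2))
    (a : 'M[A]_(k, k.+2)) : 'M[A]_k.+2 :=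
  \adj (row_mx c a^T : 'M_(2 + k)).

Lemma mul_kernel_mx (A : comNzRingType) c a (i : 'I_2) :
  a *m (row (lshift k i) (@kernel_mx A c a : 'M_(2 + k)))^T = 0.
Proof.
apply: trmx_inj; rewrite trmx_mul trmxK trmx0.
rewrite -row_mul; have : (kernel_mx c a : 'M_(2 + k)) *m (row_mx c a^T) =
  (\det (row_mx c a^T : 'M_(2 + k)))%:M by exact: mul_adj_mx.
rewrite mul_mx_row scalar_mx_block => /(congr1 (@rsubmx _ _ 2 k)).
by rewrite row_mxKr block_mxEh row_mxKr => ->; rewrite rowKu row0.
Qed.

Lemma map_kernel_mx (A B : comNzRingType) (f : {rmorphism A -> B}) c a :
  map_mx f (kernel_mx c a) = kernel_mx (map_mx f c) (map_mx f a).
Proof.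
rewrite /kernel_mx map_mx_adj map_trmx; congr (\adj _).
exact: (@map_row_mx _ _ f _ 2 k).
Qed.

End KernelMx.

Section GenericKernel.
Variables (K : numFieldType) (m k p q : nat).
Local Notation I := ('I_m * 'I_k * 'I_k.+2)%type.

Variable E : forall A : comNzRingType,
  ('I_m -> 'rV[A]_k.+2) -> ('I_m -> 'rV[A]_k.+2) -> 'M[A]_(p, q).

Definition natural_mx :=
  forall (A B : comNzRingType) (f : {rmorphism A -> B}) u v,
  map_mx f (E u v) = E (fun i => map_mx f (u i)) (fun i => map_mx f (v i)).

(** In particular the row space of [E] depends only on the planes spanned by the pairs, not on the
    chosen points. *)
Definition span_monotone_mx := forall (F : fieldType) u v u' v',
  (forall i, (u i <= col_mx (u' i) (v' i))%MS) ->
  (forall i, (v i <= col_mx (u' i) (v' i))%MS) ->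
  (@E F u v <= @E F u' v')%MS.

(** Take an invertible [U] whose first two rows span a space containing [u] and [v], and let [c] and
    [a] be the blocks of its inverse: the adjugate of that inverse is proportional to [U]. The
    vectors may be dependent. *)
Lemma plane_kernel_mx (F : fieldType) (u v : 'rV[F]_k.+2) :
  exists c a, forall B : 'M_(2, _),
    B = usubmx (kernel_mx c a : 'M_(2 + k, _)) -> (col_mx u v <= B)%MS.
Proof.
pose U : 'M_(2 + k) := row_ebase (col_mx u v).
have Uu : U \in unitmx by exact: row_ebase_unit.
exists (lsubmx (invmx U : 'M_(2 + k, 2 + k))).
exists (rsubmx (invmx U : 'M_(2 + k, 2 + k)))^T => B ->.
rewrite /kernel_mx trmxK hsubmxK.
have adjE : \adj (invmx U) = \det (invmx U) *: U.
  have := mul_adj_mx (invmx U) => /(congr1 (mulmx^~ U)).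
  by rewrite mulmxKV // mul_scalar_mx.
rewrite adjE linearZ /= eqmx_scale; last first.
  by rewrite -unitfE -unitmxE unitmx_inv.
rewrite -(mulmx_ebase (col_mx u v)) -/U -mulmxA.
(* The rank is at most 2, so only the first two rows of [U] are involved. *)
have -> : pid_mx (\rank (col_mx u v)) *m U =
  (pid_mx (\rank (col_mx u v)) : 'M_2) *m usubmx U.
  rewrite -{1}(vsubmxK U); set r := \rank _.
  have -> : pid_mx r = row_mx (pid_mx r : 'M_2) (0 : 'M[F]_(2, k)).
    rewrite -[LHS]hsubmxK; congr row_mx; apply/matrixP => i j; rewrite !mxE //=.
    have : (r <= 2)%N by exact: rank_leq_row.
    by case: eqP => //= ij h; rewrite ij ltnNge (leq_trans h) ?leq_addr.
  by rewrite mul_row_col mul0mx addr0.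
by rewrite mulmxA submxMl.
Qed.

Definition kernel_row (A : comNzRingType) (j : 'I_2) (c : 'I_m -> 'M[A]_(k.+2, 2))
    (a : 'I_m -> 'M[A]_(k, k.+2)) (i : 'I_m) : 'rV[A]_k.+2 :=
  row (lshift k j) (kernel_mx (c i) (a i) : 'M_(2 + k, _)).

Lemma map_kernel_row (A B : comNzRingType) (f : {rmorphism A -> B}) j c a :
  (fun i => map_mx f (kernel_row j c a i)) =
  kernel_row j (fun i => map_mx f (c i)) (fun i => map_mx f (a i)).
Proof. by apply/funext => i; rewrite map_row map_kernel_mx. Qed.

Lemma generic_kernel_rank (a : 'I_m -> 'M[K]_(k, k.+2))
    (u0 v0 : 'I_m -> 'rV[rat]_k.+2) :
  alg_independent_over_rat (fun t : I => a t.1.1 t.1.2 t.2) ->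
  natural_mx -> span_monotone_mx ->
  exists u v : 'I_m -> 'rV[K]_k.+2,
    [/\ forall i, a i *m (u i)^T = 0, forall i, a i *m (v i)^T = 0 &
        (\rank (E u0 v0) <= \rank (E u v))%N].
Proof.
move=> indep Enat Emono.
have /choice[c0 /choice[a0 span0]] := fun i => plane_kernel_mx (u0 i) (v0 i).
(* The auxiliary columns [c0] are those of the rational configuration; only the equations become
   generic. *)
exists (kernel_row 0 (fun i => map_mx ratr (c0 i)) a).
exists (kernel_row 1 (fun i => map_mx ratr (c0 i)) a).
split=> [i|i|]; [exact: mul_kernel_mx|exact: mul_kernel_mx|].
have := mxrank_factor1 (E (kernel_row 0 c0 a0) (kernel_row 1 c0 a0)).
set r := \rank (E (kernel_row 0 _ _) _) => -[C [D CD]].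
have r0 : (\rank (E u0 v0) <= r)%N.
  have h i : (col_mx (u0 i) (v0 i) <=
      col_mx (kernel_row 0 c0 a0 i) (kernel_row 1 c0 a0 i))%MS.
    apply: span0; apply/matrixP => x y; rewrite mxE; case: splitP => j xj;
    by rewrite !mxE; congr (_ _ _); apply: val_inj; rewrite /= xj ord1.
  apply: mxrankS; apply: Emono => i; apply: submx_trans (h i).
    by rewrite -addsmxE addsmxSl.
  by rewrite -addsmxE addsmxSr.
apply: leq_trans r0 _.
pose P := {mpoly rat[#|{: I}|]}.
pose X i : 'M[P]_(k, k.+2) := \matrix_(x, y) 'X_(enum_rank (i, x, y)).
pose cst p' q' (M : 'M[rat]_(p', q')) : 'M[P]_(p', q') :=
  map_mx (@mpolyC _ rat) M.
(* [G] is a rational polynomial in the coefficients of the equations. Its value at [a0] is 1, so it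
   is nonzero, and algebraic independence makes it nonzero at [a]. *)
pose G := \det (cst _ _ C *m E (kernel_row 0 (fun i => cst _ _ (c0 i)) X)
   (kernel_row 1 (fun i => cst _ _ (c0 i)) X) *m cst _ _ D).
have mapG (A : comNzRingType) (f : {rmorphism P -> A}) : f G =
  \det (map_mx f (cst _ _ C) *m
    E (kernel_row 0 (fun i => map_mx f (cst _ _ (c0 i))) (fun i => map_mx f (X i)))
      (kernel_row 1 (fun i => map_mx f (cst _ _ (c0 i))) (fun i => map_mx f (X i)))
    *m map_mx f (cst _ _ D)).
  by rewrite -det_map_mx !map_mxM Enat !map_kernel_row.
have G0 : G != 0.
  apply/eqP => G0; pose pt (z : 'I_#|{: I}|) :=
    let t := enum_val z in a0 t.1.1 t.1.2 t.2.
  have evc p' q' (M : 'M[rat]_(p', q')) : map_mx (meval pt) (cst _ _ M) = M.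
    by apply/matrixP => x y; rewrite !mxE mevalC.
  have evX : (fun i => map_mx (meval pt) (X i)) = a0.
    by apply/funext => i; apply/matrixP => x y; rewrite !mxE mevalXU /pt enum_rankK.
  have evc0 : (fun i => map_mx (meval pt) (cst _ _ (c0 i))) = c0.
    by apply/funext => i; rewrite evc.
  have := mapG _ (meval pt); rewrite G0 rmorph0 !evc evX evc0 CD det1 => /eqP.
  by rewrite eq_sym oner_eq0.
have := indep G G0; set pt := fun z : 'I__ => _.
have evc p' q' (M : 'M[rat]_(p', q')) :
    map_mx (mmap ratr pt) (cst _ _ M) = map_mx (@ratr K) M.
  by apply/matrixP => x y; rewrite !mxE mmapC.
have evX : (fun i => map_mx (mmap (@ratr K) pt) (X i)) = a.
  apply/funext => i; apply/matrixP => x y.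
  by rewrite !mxE mmapX mmap1U /pt enum_rankK.
have evc0 : (fun i => map_mx (mmap ratr pt) (cst _ _ (c0 i))) =
    (fun i => map_mx (@ratr K) (c0 i)).
  by apply/funext => i; rewrite evc.
by rewrite mapG !evc evX evc0; exact: mxrank_of_det.
Qed.

End GenericKernel.

(** Indexes the quadratic monomials in [k] variables. *)
Definition upper_pair k := {p : 'I_k * 'I_k | (p.1 <= p.2)%N}.

Lemma card_upper_pair k : #|{: upper_pair k}| = (k * k.+1)./2.
Proof.
have -> : #|{: upper_pair k}| = (\sum_(j < k) j.+1)%N.
  rewrite card_sig -sum1_card.
  rewrite (eq_bigl (fun p : 'I_k * 'I_k => (p.1 <= p.2)%N)) //.
  rewrite -(pair_big_dep xpredT (fun i j : 'I_k => (i <= j)%N) (fun _ _ => 1%N)) /=.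
  rewrite (exchange_big_dep xpredT) //=; apply: eq_bigr => j _.
  by rewrite -(big_ord_widen k (fun=> 1%N) (ltn_ord j)) sum1_card card_ord.
elim: k => [|k IH]; first by rewrite big_ord0.
by rewrite big_ord_recr /= IH; lia.
Qed.

(** * Matrices evaluating linear and quadratic forms on lines *)

Section EvaluationMx.
Variables (k m : nat).

Definition square_row (A : comNzRingType) (u : 'rV[A]_k) : 'rV[A]_#|{: upper_pair k}| :=
  \row_c (u 0 (val (enum_val c)).1 * u 0 (val (enum_val c)).2).

Definition polar_row (A : comNzRingType) (u v : 'rV[A]_k) : 'rV[A]_#|{: upper_pair k}| :=
  \row_c (u 0 (val (enum_val c)).1 * v 0 (val (enum_val c)).2 +
          v 0 (val (enum_val c)).1 * u 0 (val (enum_val c)).2).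

Definition plane_row (A : comNzRingType) (u v : 'rV[A]_k) (j : 'I_3) :=
  if j == 0 :> nat then square_row u
  else if j == 1 :> nat then polar_row u v else square_row v.

(* Row [(i, j)] lists the coefficients of [s^(2-j) t^j] in the values of the
   quadratic monomials at [s u_i + t v_i]. *)
Definition quadrics_mx (A : comNzRingType) (u v : 'I_m -> 'rV[A]_k) :
    'M[A]_(#|{: 'I_m * 'I_3}|, #|{: upper_pair k}|) :=
  \matrix_r plane_row (u (enum_val r).1) (v (enum_val r).1) (enum_val r).2.

(** Over a field, full column rank means that no nonzero linear form vanishes at all these
    points. *)
Definition linear_mx (A : comNzRingType) (u v : 'I_m -> 'rV[A]_k) : 'M[A]_(m + m, k) :=
  col_mx (\matrix_i u i) (\matrix_i v i).

Lemma map_plane_row (A B : comNzRingType) (f : {rmorphism A -> B}) u v j :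
  map_mx f (plane_row u v j) = plane_row (map_mx f u) (map_mx f v) j.
Proof.
rewrite /plane_row; case: ifP => _; last case: ifP => _;
by apply/rowP => c; rewrite !mxE ?rmorphD !rmorphM.
Qed.

Lemma linear_mx_natural (A B : comNzRingType) (f : {rmorphism A -> B}) u v :
  map_mx f (linear_mx u v) =
  linear_mx (fun i => map_mx f (u i)) (fun i => map_mx f (v i)).
Proof.
by rewrite /linear_mx map_col_mx; congr col_mx; apply/matrixP => i j; rewrite !mxE.
Qed.

Lemma quadrics_mx_natural (A B : comNzRingType) (f : {rmorphism A -> B}) u v :
  map_mx f (quadrics_mx u v) =
  quadrics_mx (fun i => map_mx f (u i)) (fun i => map_mx f (v i)).
Proof.
by apply/row_matrixP => r; rewrite -map_row !rowK map_plane_row.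
Qed.

Lemma sub_col_mx2 (F : fieldType) (u' v' x : 'rV[F]_k) :
  (x <= col_mx u' v')%MS -> exists a b, x = a *: u' + b *: v'.
Proof.
move=> /submxP[w ->]; exists (lsubmx (w : 'rV_(1 + 1)) 0 0).
exists (rsubmx (w : 'rV_(1 + 1)) 0 0).
rewrite -{1}(hsubmxK (w : 'rV_(1 + 1))) mul_row_col.
rewrite {1}[lsubmx w]mx11_scalar {1}[rsubmx w]mx11_scalar.
by rewrite !mul_scalar_mx.
Qed.

Section Field.
Variable F : fieldType.
Implicit Types u v : 'I_m -> 'rV[F]_k.

Lemma linear_mx_span_monotone u v u' v' :
  (forall i, (u i <= col_mx (u' i) (v' i))%MS) ->
  (forall i, (v i <= col_mx (u' i) (v' i))%MS) ->
  (linear_mx u v <= linear_mx u' v')%MS.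
Proof.
move=> hu hv.
have h i : (col_mx (u' i) (v' i) <= linear_mx u' v')%MS.
  by rewrite col_mx_sub -!addsmxE; apply/andP; split;
    [apply: submx_trans (addsmxSl _ _)|apply: submx_trans (addsmxSr _ _)];
    rewrite -[X in (X <= _)%MS](rowK (fun i => _ i) i) row_sub.
rewrite col_mx_sub; apply/andP; split; apply/row_subP => i; rewrite rowK;
exact: submx_trans (h i).
Qed.

Lemma plane_row_sub u v i j : (plane_row (u i) (v i) j <= quadrics_mx u v)%MS.
Proof.
have := row_sub (enum_rank (i, j)) (quadrics_mx u v).
by rewrite rowK enum_rankK.
Qed.

Lemma quadrics_mx_span_monotone u v u' v' :
  (forall i, (u i <= col_mx (u' i) (v' i))%MS) ->
  (forall i, (v i <= col_mx (u' i) (v' i))%MS) ->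
  (quadrics_mx u v <= quadrics_mx u' v')%MS.
Proof.
move=> hu hv; apply/row_subP => r; rewrite rowK.
case: (enum_val r) => i j /=.
have [a [b uE]] := sub_col_mx2 (hu i); have [c [d vE]] := sub_col_mx2 (hv i).
have s0 := plane_row_sub u' v' i 0; have s1 := plane_row_sub u' v' i 1.
have s2 := plane_row_sub u' v' i 2%:R.
rewrite /plane_row /= in s0 s1 s2.
rewrite /plane_row; case: ifP => _; last case: ifP => _.
- have -> : square_row (u i) = (a ^+ 2) *: square_row (u' i) +
      (a * b) *: polar_row (u' i) (v' i) + (b ^+ 2) *: square_row (v' i).
    by rewrite uE; apply/rowP => l; rewrite !mxE; ring.
  by rewrite !addmx_sub ?scalemx_sub.
- have -> : polar_row (u i) (v i) = (2 * (a * c)) *: square_row (u' i) +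
      (a * d + b * c) *: polar_row (u' i) (v' i) +
      (2 * (b * d)) *: square_row (v' i).
    by rewrite uE vE; apply/rowP => l; rewrite !mxE; ring.
  by rewrite !addmx_sub ?scalemx_sub.
- have -> : square_row (v i) = (c ^+ 2) *: square_row (u' i) +
      (c * d) *: polar_row (u' i) (v' i) + (d ^+ 2) *: square_row (v' i).
    by rewrite vE; apply/rowP => l; rewrite !mxE; ring.
  by rewrite !addmx_sub ?scalemx_sub.
Qed.

End Field.
End EvaluationMx.

Lemma inj_mxrank (F : fieldType) p q (A : 'M[F]_(p, q)) :
  (forall c : 'cV_q, A *m c = 0 -> c = 0) -> \rank A = q.
Proof.
move=> inj; rewrite -mxrank_tr; apply/eqP; apply: inj_row_free => w wA.
by apply: trmx_inj; rewrite trmx0; apply: inj; rewrite -[A]trmxK -trmx_mul wA trmx0.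
Qed.

Lemma row_free_rowsub (F : fieldType) p q r (f : 'I_r -> 'I_p) (A : 'M[F]_(p, q)) :
  injective f -> row_free A -> row_free (rowsub f A).
Proof.
move=> f_inj /row_freeP[B AB]; apply/row_freeP; exists (colsub f B).
apply/matrixP => i j; move/matrixP/(_ (f i) (f j)): AB.
rewrite !mxE (inj_eq f_inj) => <-.
by apply: eq_bigr => s _; rewrite !mxE.
Qed.

(** * Rational lines of maximal rank *)

Section SpecialPosition.
Variables (k : nat).
Local Notation V := 'rV[rat]_k.

(** The polarization of the quadratic form with coefficients [c], without halving: on the diagonal
    it is twice the form. *)
Definition polar_form (c : 'cV[rat]_#|{: upper_pair k}|) (x y : V) : rat :=
  (polar_row x y *m c) 0 0.

Lemma polar_form_biadditive c : symmetric_biadditive (polar_form c).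
Proof.
split=> [x y|x y z]; rewrite /polar_form.
  by congr ((_ *m _) _ _); apply/rowP => l; rewrite !mxE; ring.
have -> : polar_row (x + y) z = polar_row x z + polar_row y z.
  by apply/rowP => l; rewrite !mxE; ring.
by rewrite mulmxDl mxE.
Qed.

Lemma polar_formxx c x : polar_form c x x = 2 * (square_row x *m c) 0 0.
Proof.
rewrite /polar_form; have -> : polar_row x x = 2 *: square_row x.
  by apply/rowP => l; rewrite !mxE; ring.
by rewrite -scalemxAl mxE.
Qed.

(** The value at the basis vectors of an ordered pair is the corresponding coefficient of [c],
    doubled if the two indices agree. *)
Lemma polar_form_eq0 c :
  null_on (polar_form c) [seq delta_mx 0 i | i <- enum 'I_k] -> c = 0.
Proof.
move=> null; apply/colP => r; rewrite [RHS]mxE.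
pose p := val (enum_val r).
have := null (delta_mx 0 p.1) (delta_mx 0 p.2).
rewrite !map_f ?mem_enum // => /(_ isT isT).
rewrite /polar_form mxE (bigD1 r) //= big1 ?addr0 => [|l lr].
  rewrite !mxE !eqxx /= -/p mul1r => /eqP; rewrite mulf_eq0 => /orP[|/eqP//].
  by case: (p.1 == p.2); case: (p.2 == p.1); rewrite ?mulr0 ?mul0r ?addr0 ?mulr1.
rewrite !mxE !eqxx /=; set p' := val (enum_val l).
have p'p : p' != p.
  by apply: contra lr => /eqP/val_inj/enum_val_inj->.
have le1 : (p.1 <= p.2)%N by exact: (valP (enum_val r)).
have le2 : (p'.1 <= p'.2)%N by exact: (valP (enum_val l)).
have pE : p' = p -> False by move/eqP; apply/negP.
rewrite -!natrM !mulnb.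
have -> : (p'.1 == p.1) && (p'.2 == p.2) = false.
  apply/negP => /andP[/eqP e1 /eqP e2]; apply: pE.
  by rewrite [p']surjective_pairing [p]surjective_pairing e1 e2.
have -> : (p'.1 == p.2) && (p'.2 == p.1) = false.
  apply/negP => /andP[/eqP e1 /eqP e2]; apply: pE.
  rewrite e1 e2 in le2; have e : p.1 = p.2 by apply/ord_inj/eqP; rewrite eqn_leq le1 le2.
  by rewrite [p']surjective_pairing [p]surjective_pairing e1 e2 e.
by rewrite addr0 mul0r.
Qed.

Lemma special_quadrics m : (3 < k)%N ->
  exists u0 v0 : 'I_m -> V,
    \rank (quadrics_mx u0 v0) = minn (3 * m) #|{: upper_pair k}|.
Proof.
move=> k3.
pose B : seq V := [seq delta_mx 0 i | i <- enum 'I_k].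
have sB : size B = k by rewrite size_map size_enum_ord.
have [||L [P [sLP sP LP]]] := @null_configuration_exists _ B.
- by rewrite -size_eq0 sB; lia.
- by rewrite sB; lia.
rewrite sB -card_upper_pair in sLP.
have polar0 c := LP _ (polar_form_biadditive c).
have isoP l (u v : 'I_l -> V) c i : quadrics_mx u v *m c = 0 ->
    isotropic (polar_form c) (u i, v i).
  move=> Q0.
  have h j : plane_row (u i) (v i) j *m c = 0.
    by have /submxP[w ->] := plane_row_sub u v i j; rewrite -mulmxA Q0 mulmx0.
  by split; rewrite /= ?polar_formxx /polar_form;
    [have := h 0|have := h 1|have := h 2%:R]; rewrite /plane_row /= => ->;
    rewrite mxE ?mulr0.
have [ml|lm] := leqP m (size L).
  pose l := size L.
  pose u (i : 'I_l) := (nth (0, 0) L i).1; pose v (i : 'I_l) := (nth (0, 0) L i).2.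
  pose S : 'M_(size P, _) := \matrix_i square_row (nth (0 : V) P i).
  (* This matrix has as many rows as columns, so injectivity also makes its rows independent; the
     first [m] lines of [L] then suffice. *)
  have rk : \rank (col_mx (quadrics_mx u v) S) = #|{: upper_pair k}|.
    apply: inj_mxrank => c; rewrite mul_col_mx => /eqP.
    rewrite col_mx_eq0 => /andP[/eqP Q0 /eqP S0]; apply: polar_form_eq0.
    apply: polar0 => [t tL|p pP].
      have tl : (index t L < l)%N by rewrite index_mem.
      have := isoP _ _ _ _ (Ordinal tl) Q0.
      by rewrite /u /v /= nth_index //; case: t {tL tl}.
    have pl : (index p P < size P)%N by rewrite index_mem.
    have := congr1 (row (Ordinal pl)) S0; rewrite row_mul rowK /= nth_index // row0.
    by rewrite polar_formxx => ->; rewrite mxE mulr0.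
  have Qfree : row_free (quadrics_mx u v).
    have := mxrank_adds_leqif (quadrics_mx u v) S => -[+ _].
    rewrite addsmxE rk /row_free => h.
    have := rank_leq_row (quadrics_mx u v); have := rank_leq_row S.
    have cE : #|{: 'I_l * 'I_3}| = (l * 3)%N by rewrite card_prod !card_ord.
    by rewrite /l in cE h *; lia.
  exists (fun i => u (widen_ord ml i)), (fun i => v (widen_ord ml i)).
  pose f (r : 'I_#|{: 'I_m * 'I_3}|) : 'I_#|{: 'I_l * 'I_3}| :=
    enum_rank (widen_ord ml (enum_val r).1, (enum_val r).2).
  have f_inj : injective f.
    move=> r1 r2 /enum_rank_inj[e1 e2]; apply: enum_val_inj.
    rewrite [LHS]surjective_pairing [RHS]surjective_pairing e2.
    by congr pair; apply: val_inj.
  have -> : quadrics_mx (fun i => u (widen_ord ml i)) (fun i => v (widen_ord ml i))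
      = rowsub f (quadrics_mx u v).
    by apply/row_matrixP => r; rewrite row_rowsub !rowK enum_rankK.
  have := row_free_rowsub f_inj Qfree; rewrite /row_free => /eqP->.
  by rewrite card_prod !card_ord; lia.
(* There is room for one more line, so the point of [P], if any, is entered as a degenerate line;
   the remaining lines default to zero pairs. *)
pose M := L ++ [seq (p, p) | p <- P].
exists (fun i => (nth (0, 0) M i).1), (fun i => (nth (0, 0) M i).2).
rewrite (_ : minn _ _ = #|{: upper_pair k}|); last by lia.
apply: inj_mxrank => c Q0; apply: polar_form_eq0.
have sM : (size M <= m)%N by rewrite size_cat size_map; lia.
have isoM t : t \in M -> isotropic (polar_form c) t.
  move=> tM; have tm : (index t M < m)%N by apply: leq_trans sM; rewrite index_mem.
  by have := isoP _ _ _ _ (Ordinal tm) Q0; rewrite /= nth_index //.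
apply: polar0 => [t tL|p pP]; first by apply: isoM; rewrite mem_cat tL.
by have [|] := isoM (p, p); rewrite ?mem_cat ?map_f ?orbT.
Qed.

Lemma special_linear m : (k <= 2 * m)%N ->
  exists u0 v0 : 'I_m -> V, \rank (linear_mx u0 v0) = k.
Proof.
move=> km.
(* Line [i] joins the coordinate points [2 * i] and [(2 * i).+1], so coordinate [j] is detected by
   line [j./2]; an index beyond the last coordinate gives a zero row. *)
exists (fun i => \row_j (j == (2 * i)%N :> nat)%:R).
exists (fun i => \row_j (j == (2 * i).+1 :> nat)%:R).
apply: inj_mxrank => c; rewrite mul_col_mx => /eqP.
rewrite col_mx_eq0 => /andP[/eqP U0 /eqP V0]; apply/colP => j.
have jm : (j./2 < m)%N by have := ltn_ord j; lia.
have [jo|je] := boolP (odd j).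
  move/matrixP/(_ (Ordinal jm) 0): V0; rewrite !mxE (bigD1 j) //=.
  rewrite big1 => [|i ij]; rewrite !mxE /=.
    by rewrite (_ : (j == _ :> nat) = true) ?mul1r ?addr0 //; lia.
  rewrite (_ : (i == _ :> nat) = false) ?mul0r //.
  by apply: contra_neqF ij => /eqP ij; apply: val_inj => /=; lia.
move/matrixP/(_ (Ordinal jm) 0): U0; rewrite !mxE (bigD1 j) //=.
rewrite big1 => [|i ij]; rewrite !mxE /=.
  by rewrite (_ : (j == _ :> nat) = true) ?mul1r ?addr0 //; lia.
rewrite (_ : (i == _ :> nat) = false) ?mul0r //.
by apply: contra_neqF ij => /eqP ij; apply: val_inj => /=; lia.
Qed.

End SpecialPosition.

(** * The grading of the coordinate ring *)

Section Homogeneous.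
Variables (K : fieldType) (k : nat).
Local Notation S := {mpoly K[k]}.

Lemma pihomogM d e (p q : S) : q \is e.-homog ->
  pihomog mdeg d (p * q) =
  if (e <= d)%N then pihomog mdeg (d - e) p * q else 0.
Proof.
move=> qe.
have [N [P [Ph ->]]] : exists N (P : nat -> S),
    (forall i, P i \is i.-homog) /\ p = \sum_(i < N) P i.
  exists (mmeasure mdeg p), (fun i => pihomog mdeg i p).
  by split=> [i|]; [exact: pihomogP|exact: pihomog_partitionE].
have pid (i j : nat) : pihomog mdeg i (P j) = if j == i then P j else 0.
  by case: eqVneq => [<-|/pihomog_ne0->//]; rewrite ?pihomog_dE.
rewrite mulr_suml raddf_sum /=; case: ifP => de.
  rewrite raddf_sum mulr_suml; apply: eq_bigr => i _ /=; rewrite pid.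
  have iq : P i * q \is (i + e).-homog by exact: dhomogM.
  case: eqP => ide.
    by rewrite pihomog_dE // (_ : d = i + e)%N //; lia.
  by rewrite (pihomog_ne0 _ iq) ?mul0r //; apply/eqP; lia.
rewrite big1 // => i _; have iq : P i * q \is (i + e).-homog by exact: dhomogM.
by rewrite (pihomog_ne0 _ iq) //; apply/eqP; lia.
Qed.

Lemma homogS_decomposition d (f : S) : f \is d.+1.-homog ->
  exists2 F : 'I_k -> S, forall j, F j \is d.-homog & f = \sum_j F j * 'X_j.
Proof.
move=> /dhomogP; rewrite [X in exists2 _, _ & X = _](mpolyE f).
elim: (msupp f) => [_|mon r IH h].
  exists (fun=> 0) => [j|]; first exact: dhomog0.
  by rewrite big_nil big1 // => j _; rewrite mul0r.
have [|F Fd FE] := IH; first by move=> x xr; apply: h; rewrite inE xr orbT.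
have md : mdeg mon = d.+1 by apply: h; rewrite inE eqxx.
have /existsP[j mj] : [exists j, mon j != 0%N].
  apply: contraT => /existsPn h0; move: md; rewrite mdegE big1 // => j _.
  by apply/eqP; rewrite -[_ == _]negbK h0.
have Um : (U_(j) <= mon)%MM by rewrite lep1mP.
exists (fun i => F i + (i == j)%:R *: (f@_mon *: 'X_[mon - U_(j)])) => [i|].
  rewrite rpredD ?Fd // !rpredZ // dhomogX; have := mdegD (mon - U_(j)) U_(j).
  by rewrite submK // md mdeg1 addn1 => -[->].
rewrite big_cons FE addrC.
under [RHS]eq_bigr do rewrite mulrDl.
rewrite big_split /=; congr (_ + _); rewrite (bigD1 j) //= eqxx scale1r.
rewrite big1 ?addr0 => [|i /negPf->]; last by rewrite scale0r mul0r.
by rewrite -scalerAl -mpolyXD submK.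
Qed.

End Homogeneous.

Lemma meval_linear_form (K : fieldType) k (a x : 'rV[K]_k) :
  (linear_form a).@[fun j => x 0 j] = (a *m x^T) 0 0.
Proof.
rewrite /linear_form raddf_sum /= !mxE; apply: eq_bigr => j _.
by rewrite mevalZ mevalXU mxE.
Qed.

Lemma linear_form_homog (K : fieldType) k (a : 'rV[K]_k) :
  linear_form a \is 1.-homog.
Proof. by apply: rpred_sum => j _; rewrite rpredZ // dhomogX /= mdeg1. Qed.

(** * The ideal of a line and the equations of its cone *)

Section LineIdeal.
Variables (K : fieldType) (n : nat) (L : line K n).
Local Notation S := {mpoly K[n.+1]}.

Definition vanishes_on (f : S) :=
  forall x : 'rV[K]_n.+1, x \in cone L -> f.@[fun j => x 0 j] = 0.

Lemma line_ideal_vanishes f : line_ideal L f -> vanishes_on f.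
Proof.
move=> [s [sF ->]] x xL; rewrite raddf_sum /= big_seq big1 // => t /sF[_ tL].
by rewrite mevalM tL ?mulr0.
Qed.

Lemma homog_line_ideal d f : f \is d.-homog -> line_ideal L f <-> vanishes_on f.
Proof.
move=> fd; split; first exact: line_ideal_vanishes.
move=> fL; exists [:: (1, f)]; split; last by rewrite big_seq1 mul1r.
by move=> t; rewrite inE => /eqP->; split=> //; exists d.
Qed.

Lemma line_ideal_pihomog d f : line_ideal L f -> line_ideal L (pihomog mdeg d f).
Proof.
move=> [s [sF ->]]; rewrite raddf_sum /= big_seq.
apply: (big_ind (line_ideal L)); [exact: ideal_span0|exact: ideal_spanD|].
move=> t /sF[[e te] tL]; rewrite (pihomogM _ _ te); case: ifP => _.
  by apply: ideal_spanM; exact: (proj2 (homog_line_ideal te) tL).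
exact: ideal_span0.
Qed.

Lemma separating_linear_form x : x \notin cone L ->
  exists a : 'rV[K]_n.+1, vanishes_on (linear_form a) /\ (a *m x^T) 0 0 != 0.
Proof.
move=> xL; pose g (z : 'rV[K]_n.+1) := z - projv (cone L) z.
have gx : g x != 0.
  apply: contra xL; rewrite subr_eq0 => /eqP->; exact: memv_proj.
have /rV0Pn[j gxj] := gx.
pose a : 'rV[K]_n.+1 := \row_i g (delta_mx 0 i) 0 j.
have aE z : (a *m z^T) 0 0 = g z 0 j.
  have -> : g z = \sum_i z 0 i *: g (delta_mx 0 i).
    rewrite {1}(row_sum_delta z) /g linear_sum -sumrB.
    by apply: eq_bigr => i _; rewrite linearZ scalerBr.
  by rewrite summxE mxE; apply: eq_bigr => i _; rewrite !mxE mulrC.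
exists a; split; last by rewrite aE.
move=> z zL; rewrite meval_linear_form aE /g projv_id // subrr mxE //.
Qed.

(** A common zero of the generators is a zero of the whole ideal; outside the cone this would
    contradict the existence of a separating linear form. *)
Lemma generated_line_ideal_cone p (a : 'M[K]_(p, n.+1)) :
  (forall f, line_ideal L f <->
     ideal_span (fun f => exists k, f = linear_form (row k a)) f) ->
  forall x, (x \in cone L) = (a *m x^T == 0).
Proof.
move=> La x; apply/idP/eqP => [xL|ax].
  apply/colP => k; rewrite mxE.
  have /line_ideal_vanishes/(_ x xL) : line_ideal L (linear_form (row k a)).
    apply/La; exists [:: (1, linear_form (row k a))].
    split; last by rewrite big_seq1 mul1r.
    by move=> t; rewrite inE => /eqP->; exists k.
  by rewrite meval_linear_form -row_mul !mxE.
apply: contraT => /separating_linear_form[b [bL bx]].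
have /La[s [sF sE]] : line_ideal L (linear_form b).
  exact: (proj2 (homog_line_ideal (linear_form_homog b)) bL).
move: bx; rewrite -meval_linear_form sE raddf_sum /= big_seq big1 ?eqxx //.
move=> t /sF[k ->]; rewrite mevalM meval_linear_form -row_mul ax.
by rewrite row0 mxE mulr0.
Qed.

End LineIdeal.

Section GradedRing.
Variables (K : fieldType) (n m : nat) (M : 'I_m -> line K n).
Local Notation S := {mpoly K[n.+1]}.
Local Notation J := (lines_ideal M).
Local Notation A := (coordinate_ring M).
Local Notation gr := (coordinate_grading M).

Lemma homog_lines_ideal d f : f \is d.-homog ->
  f \in J <-> forall i, vanishes_on (M i) f.
Proof.
move=> fd; split=> [/asboolP h i|h].
  exact/(homog_line_ideal _ fd).
by apply/asboolP => i; apply/(homog_line_ideal _ fd).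
Qed.

Lemma lines_ideal_pihomog d f : f \in J -> pihomog mdeg d f \in J.
Proof. by move=> /asboolP h; apply/asboolP => i; exact: line_ideal_pihomog. Qed.

Lemma piD (f g : S) : \pi_A (f + g) = \pi_A f + \pi_A g.
Proof. by rewrite !piE. Qed.

Lemma piM (f g : S) : \pi_A (f * g) = \pi_A f * \pi_A g.
Proof. by rewrite -coordinate_pi_mul. Qed.

Lemma pi0 : \pi_A 0 = 0.
Proof. by rewrite !piE. Qed.

Lemma pi_eq (f g : S) : \pi_A f = \pi_A g <-> f - g \in J.
Proof. by rewrite Quotient.idealrBE; split=> /eqP. Qed.

Lemma pi_eq0 (f : S) : \pi_A f = 0 <-> f \in J.
Proof. by rewrite -pi0 pi_eq subr0. Qed.

Lemma pi_sum I (r : seq I) (Q : pred I) (F : I -> S) :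
  \pi_A (\sum_(i <- r | Q i) F i) = \sum_(i <- r | Q i) \pi_A (F i).
Proof. by apply: (big_morph (\pi_A) piD); exact: pi0. Qed.

(** The choice of representative is immaterial because the ideal is homogeneous; see
    [component_pi]. *)
Definition component (d : nat) (x : A) : A := \pi_A (pihomog mdeg d (repr x)).

Lemma component_pi d f : component d (\pi_A f) = \pi_A (pihomog mdeg d f).
Proof.
by apply/pi_eq; rewrite -raddfB; apply: lines_ideal_pihomog; apply/pi_eq; rewrite reprK.
Qed.

Lemma componentD d x y : component d (x + y) = component d x + component d y.
Proof.
by elim/quotW: x => f; elim/quotW: y => g; rewrite -piD !component_pi raddfD piD.
Qed.

Lemma component0 d : component d 0 = 0.
Proof. by rewrite -pi0 component_pi raddf0. Qed.

Lemma component_sum d I (r : seq I) (Q : pred I) (F : I -> A) :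
  component d (\sum_(i <- r | Q i) F i) = \sum_(i <- r | Q i) component d (F i).
Proof. by apply: (big_morph (component d) (@componentD d)); exact: component0. Qed.

Lemma component_gr d x : gr d (component d x).
Proof. by exists (pihomog mdeg d (repr x)) => //; exact: pihomogP. Qed.

Lemma component_id d x : gr d x -> component d x = x.
Proof. by case=> f fd ->; rewrite component_pi pihomog_dE. Qed.

Lemma component_ne d e x : d != e -> gr e x -> component d x = 0.
Proof.
by move=> de [f fe ->]; rewrite component_pi (pihomog_ne0 _ fe) ?pi0 // eq_sym.
Qed.

Lemma componentM d e x y : gr e y ->
  component d (x * y) = if (e <= d)%N then component (d - e) x * y else 0.
Proof.
case=> g ge ->; elim/quotW: x => f; rewrite -piM !component_pi (pihomogM _ _ ge).
by case: ifP => _; rewrite ?pi0 ?piM.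
Qed.

Lemma grM d e x y : gr d x -> gr e y -> gr (d + e) (x * y).
Proof.
by case=> f fd -> [g ge ->]; exists (f * g); [exact: dhomogM|rewrite piM].
Qed.

Lemma grD d x y : gr d x -> gr d y -> gr d (x + y).
Proof.
by case=> f fd -> [g ge ->]; exists (f + g); [exact: rpredD|rewrite piD].
Qed.

Lemma gr0 d : gr d 0.
Proof. by exists 0; [exact: dhomog0|rewrite pi0]. Qed.

Lemma gr_sum d I (r : seq I) (F : I -> A) :
  (forall i, gr d (F i)) -> gr d (\sum_(i <- r) F i).
Proof.
by move=> Fd; apply: (big_ind (gr d)) => //; [exact: gr0|exact: grD].
Qed.

Lemma irrelevantP x : irrelevant_ideal gr x <-> component 0 x = 0.
Proof.
split=> [[N [f [fd ->]]]|].
  rewrite component_sum big_nat big1 // => d /andP[d0 _].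
  by apply: component_ne (fd d); lia.
move=> x0; exists (mmeasure mdeg (repr x)).+1, (fun d => component d x).
split=> [d|]; first exact: component_gr.
rewrite -{1}[x]reprK {1}(pihomog_partitionE (leqnSn (mmeasure mdeg (repr x)))).
by rewrite pi_sum -(big_mkord xpredT (fun d => component d x)) big_ltn // x0 add0r.
Qed.

End GradedRing.

(** * Linear strands of a resolution *)

Lemma linfun_exists (K : fieldType) (U W : vectType K) (f : U -> W) :
  linear f -> exists F : 'Hom(U, W), F =1 f.
Proof.
move=> lin; pose g := GRing.isLinear.Build K U W *:%R f lin.
pose h : {linear U -> W} := HB.pack f g.
by exists (linfun h) => x; rewrite lfunE.
Qed.

Section GradedBasis.
Variables (K : fieldType) (n m : nat) (M : 'I_m -> line K n).
Local Notation S := {mpoly K[n.+1]}.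
Local Notation J := (lines_ideal M).
Local Notation A := (coordinate_ring M).
Local Notation gr := (coordinate_grading M).

(** [beta] lifts a K-basis of the degree [d] part of the coordinate ring, so [h] is the value of the
    Hilbert function at [d]. *)
Definition graded_basis (d h : nat) (beta : 'I_h -> S) :=
  [/\ forall k, beta k \is d.-homog,
      forall f, f \is d.-homog ->
        exists c : 'rV[K]_h, f - \sum_k c 0 k *: beta k \in J &
      forall c : 'rV[K]_h, \sum_k c 0 k *: beta k \in J -> c = 0].

(** Identifies matrices over K with rows of elements of degree [d], so that ranks over K can be
    used. *)
Definition coord (d h : nat) (beta : 'I_h -> S) r (X : 'M[K]_(r, h)) : 'rV[A]_r :=
  \row_i \pi_A (\sum_k X i k *: beta k).

Variables (d h : nat) (beta : 'I_h -> S) (basis : graded_basis d beta).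

Lemma coord_linear r a (X Y : 'M[K]_(r, h)) :
  coord d beta (a *: X + Y) =
  \pi_A a%:MP *: coord d beta X + coord d beta Y.
Proof.
apply/rowP => i; rewrite !mxE -piM -piD; congr (\pi_A _).
rewrite mul_mpolyC scaler_sumr -big_split /=; apply: eq_bigr => k _.
by rewrite !mxE scalerDl scalerA.
Qed.

Lemma coord_inj r (X : 'M[K]_(r, h)) : coord d beta X = 0 -> X = 0.
Proof.
move=> X0; apply/row_matrixP => i; rewrite row0.
case: basis => _ _; apply; apply/(pi_eq0 M).
under eq_bigr do rewrite mxE.
by move/rowP/(_ i): X0; rewrite !mxE.
Qed.

Lemma coord0 r : coord d beta (0 : 'M_(r, h)) = 0.
Proof.
by apply/rowP => i; rewrite !mxE big1 ?pi0 // => k _; rewrite mxE scale0r.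
Qed.

Lemma coord_injective r : injective (@coord d h beta r).
Proof.
move=> X Y XY; apply/eqP; rewrite -subr_eq0 addrC -scaleN1r; apply/eqP.
apply: coord_inj; rewrite coord_linear XY -[X in _ + X]scale1r -scalerDl.
have -> : \pi_A (-1)%:MP + 1 = 0 :> A.
  have -> : 1 = \pi_A 1 :> A by [].
  by rewrite -piD mpolyCN addNr pi0.
by rewrite scale0r.
Qed.

Lemma coord_gr r (X : 'M[K]_(r, h)) i : gr d (coord d beta X 0 i).
Proof.
case: basis => hb _ _; rewrite mxE; exists (\sum_k X i k *: beta k) => //.
by apply: rpred_sum => k _; rewrite rpredZ ?hb.
Qed.

Lemma coord_surj r (u : 'rV[A]_r) :
  (forall i, gr d (u 0 i)) -> exists X : 'M[K]_(r, h), coord d beta X = u.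
Proof.
case: basis => _ span _ ud.
have /choice[c cE] : forall i, exists c : 'rV[K]_h,
    u 0 i = \pi_A (\sum_k c 0 k *: beta k).
  by move=> i; case: (ud i) => f /span[c fc] ->; exists c; apply/pi_eq.
exists (\matrix_i c i); apply/rowP => i; rewrite mxE cE.
by under eq_bigr do rewrite mxE.
Qed.

End GradedBasis.

Section LinearStrand.
Variables (K : fieldType) (n m : nat) (M : 'I_m -> line K n).
Local Notation S := {mpoly K[n.+1]}.
Local Notation J := (lines_ideal M).
Local Notation A := (coordinate_ring M).
Local Notation gr := (coordinate_grading M).

Definition row_gr d r (u : 'rV[A]_r) := forall i, gr d (u 0 i).

Lemma component_id_row d r (u : 'rV[A]_r) :
  row_gr d u -> map_mx (component d) u = u.
Proof. by move=> ud; apply/rowP => i; rewrite mxE component_id. Qed.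

Lemma component_row_gr d r (u : 'rV[A]_r) : row_gr d (map_mx (component d) u).
Proof. by move=> i; rewrite mxE; exact: component_gr. Qed.

Lemma componentS_mulmx d r s (u : 'rV[A]_r) (D : 'M[A]_(r, s)) :
  (forall i j, gr 1 (D i j)) ->
  map_mx (component d.+1) (u *m D) = map_mx (component d) u *m D.
Proof.
move=> D1; apply/rowP => j; rewrite !mxE component_sum; apply: eq_bigr => i _.
by rewrite (componentM _ _ (D1 i j)) subn1 mxE.
Qed.

Lemma component0_mulmx r s (u : 'rV[A]_r) (D : 'M[A]_(r, s)) :
  (forall i j, gr 1 (D i j)) -> map_mx (component 0) (u *m D) = 0.
Proof.
move=> D1; apply/rowP => j; rewrite !mxE component_sum big1 // => i _.
by rewrite (componentM _ _ (D1 i j)).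
Qed.

Lemma row_gr_mulmx d r s (u : 'rV[A]_r) (D : 'M[A]_(r, s)) :
  (forall i j, gr 1 (D i j)) -> row_gr d u -> row_gr d.+1 (u *m D).
Proof.
move=> D1 ud j; rewrite mxE; apply: gr_sum => i; rewrite -addn1.
exact: grM (ud i) (D1 i j).
Qed.

Variable res : linear_resolution gr.
Local Notation b := (res_rank res).
Local Notation D := (res_diff res).

(** The differential has degree 1, so the degree [d] component of any preimage is again a
    preimage. *)
Lemma strand_exact d i (u : 'rV[A]_(b i.+1)) : row_gr d.+1 u ->
  u *m D i = 0 <-> exists2 w, row_gr d w & u = w *m D i.+1.
Proof.
move=> ud; split=> [/res_diff_exact[w uE]|[w _ uE]]; last first.
  by apply/res_diff_exact; exists w.
exists (map_mx (component d) w); first exact: component_row_gr.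
rewrite -componentS_mulmx; last exact: res_diff_homog.
by rewrite -uE component_id_row.
Qed.

Lemma strand_injective i (u : 'rV[A]_(b i.+1)) :
  row_gr 0 u -> u *m D i = 0 -> u = 0.
Proof.
move=> u0 /res_diff_exact[w uE].
rewrite -(component_id_row u0) uE component0_mulmx //; exact: res_diff_homog.
Qed.

Lemma strand_surjective d (u : 'rV[A]_(b 0)) : row_gr d.+1 u ->
  exists2 w, row_gr d w & u = w *m D 0.
Proof.
move=> ud; have /res_aug_exact[w uE] : irrelevant_ideal gr ((u *m res_aug res) 0 0).
  apply/irrelevantP; rewrite mxE component_sum big1 // => i _.
  by apply: (@component_ne _ _ _ _ _ (d.+1 + 0)) => //; apply: grM (ud i) _;
    exact: res_aug_homog.
exists (map_mx (component d) w); first exact: component_row_gr.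
rewrite -componentS_mulmx; last exact: res_diff_homog.
by rewrite -uE component_id_row.
Qed.

(** If [b 0] were zero, surjectivity of the augmentation would put -1 in the irrelevant ideal; being
    its own degree 0 component, it would be zero in the ring. *)
Lemma res_rank_gt0 : 1 \notin J -> (0 < b 0)%N.
Proof.
move=> J1; rewrite lt0n; apply: contra J1 => /eqP b0.
have [u] := res_aug_surj res; rewrite mxE big1 => [|[i ib]]; last first.
  by exfalso; rewrite b0 in ib.
move/irrelevantP; rewrite sub0r.
have -> : -1 = \pi_A (-1) :> A by rewrite !piE.
rewrite component_pi pihomog_dE ?rpredN ?dhomog1 // => /pi_eq0.
by rewrite rpredN.
Qed.

(** [rho d i] is the rank of [D i] from degree [d] to degree [d.+1]. The three identities are
    rank-nullity combined with exactness in the middle, injectivity in degree 0 and surjectivity at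
    the end of a strand. *)
Lemma Koszul_strand_ranks (h : nat -> nat) (beta : forall d, 'I_(h d) -> S) :
  (forall d, graded_basis M d (beta d)) ->
  exists rho : nat -> nat -> nat,
    [/\ forall d i, (rho d.+1 i + rho d i.+1 = b i.+1 * h d.+1)%N,
        forall i, rho 0%N i = (b i.+1 * h 0)%N &
        forall d, rho d 0%N = (b 0 * h d.+1)%N].
Proof.
move=> basis.
pose crd d r := @coord K n m M d (h d) (beta d) r.
have exT : forall p : nat * nat,
    exists F : 'Hom('M[K]_(b p.2.+1, h p.1), 'M[K]_(b p.2, h p.1.+1)),
    forall X, crd p.1.+1 _ (F X) = crd p.1 _ X *m D p.2.
  case=> d i /=.
  have /choice[f fE] : forall X : 'M[K]_(b i.+1, h d),
      exists Y, crd d.+1 _ Y = crd d _ X *m D i.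
    move=> X; apply: (coord_surj (basis d.+1)); apply: row_gr_mulmx.
      exact: res_diff_homog.
    exact: coord_gr.
  have [|F FE] := @linfun_exists _ _ _ f; last by exists F => X; rewrite FE fE.
  move=> a X Y; apply: (coord_injective (basis d.+1)).
  rewrite -/(crd d.+1 _ _) fE /crd !coord_linear -!/(crd _ _ _) !fE.
  by rewrite mulmxDl -scalemxAl.
pose T p := projT1 (cid (exT p)).
have TE p : forall X, crd p.1.+1 _ (T p X) = crd p.1 _ X *m D p.2.
  exact: projT2 (cid (exT p)).
move: T TE => T TE {exT}.
exists (fun d i => \dim (limg (T (d, i)))); split=> [d i|i|d].
- have := limg_ker_dim (T (d.+1, i)) fullv; rewrite capfv dimvf dim_matrix => dE.
  apply: (etrans _ dE); rewrite addnC; congr (\dim _ + _)%N; apply/vspaceP => X; rewrite memv_ker.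
  have XE : (T (d.+1, i) X == 0) = (crd d.+1 _ X *m D i == 0).
    rewrite -(TE (d.+1, i)); apply/eqP/eqP => [->|]; first exact: coord0.
    exact: coord_inj (basis d.+2) _ _.
  have crdX : row_gr d.+1 (crd d.+1 (b i.+1) X) by exact: coord_gr.
  rewrite XE; apply/memv_imgP/eqP => [[Y _ ->]|].
    rewrite (TE (d, i.+1)) /=.
    have crdY : row_gr d.+1 (crd d _ Y *m D i.+1).
      by apply: row_gr_mulmx; [exact: res_diff_homog|exact: coord_gr].
    by apply/(strand_exact crdY); exists (crd d _ Y) => //; exact: coord_gr.
  move/(strand_exact crdX) => [w /(coord_surj (basis d))[Y <-]].
  rewrite -(TE (d, i.+1)) => /(coord_injective (basis d.+1)) ->.
  by exists Y; rewrite ?memvf.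
- have := limg_ker_dim (T (0%N, i)) fullv; rewrite capfv dimvf dim_matrix => dE; apply: (etrans _ dE).
  rewrite (_ : lker _ = 0%VS) ?dimv0 //; apply/eqP; rewrite -subv0.
  apply/subvP => X; rewrite memv_ker memv0 => /eqP TX; apply/eqP.
  apply: (coord_inj (basis 0)); apply: strand_injective (coord_gr (basis 0) X) _.
  by rewrite -(TE (0%N, i)) TX; exact: coord0.
- rewrite (_ : limg _ = fullv) ?dimvf ?dim_matrix //.
  apply/eqP; rewrite eqEsubv subvf /=; apply/subvP => X _; apply/memv_imgP.
  have [w /(coord_surj (basis d))[Y <-]] := strand_surjective (coord_gr (basis d.+1) X).
  rewrite -(TE (d, 0%N)) => /(coord_injective (basis d.+1)) ->.
  by exists Y; rewrite ?memvf.
Qed.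

End LinearStrand.

(** * Lines lying on no quadric *)

Section NoQuadrics.
Variables (K : fieldType) (n m : nat) (M : 'I_m -> line K n).
Local Notation S := {mpoly K[n.+1]}.
Local Notation J := (lines_ideal M).
Local Notation A := (coordinate_ring M).
Local Notation gr := (coordinate_grading M).

Local Notation pi_mx := (map_mx (fun f : S => \pi_A f)).

Definition homog_mx d p q (Y : 'M[S]_(p, q)) := forall i j, Y i j \is d.-homog.

Lemma lift_mx d p q (X : 'M[A]_(p, q)) : (forall i j, gr d (X i j)) ->
  exists2 Y : 'M[S]_(p, q), homog_mx d Y & pi_mx Y = X.
Proof.
move=> Xd; pose f i j := projT1 (cid2 (Xd i j)).
exists (\matrix_(i, j) f i j) => [i j|].
  by rewrite mxE /f; case: cid2.
by apply/matrixP => i j; rewrite !mxE /f; case: cid2.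
Qed.

Lemma pi_mxM p q r (X : 'M[S]_(p, q)) (Y : 'M[S]_(q, r)) :
  pi_mx (X *m Y) = pi_mx X *m pi_mx Y.
Proof.
apply/matrixP => i j; rewrite !mxE pi_sum; apply: eq_bigr => k _.
by rewrite piM !mxE.
Qed.

Lemma homog_mxM d e p q r (X : 'M[S]_(p, q)) (Y : 'M[S]_(q, r)) :
  homog_mx d X -> homog_mx e Y -> homog_mx (d + e) (X *m Y).
Proof.
by move=> Xd Ye i j; rewrite mxE; apply: rpred_sum => k _; apply: dhomogM.
Qed.

(** A product of linear forms, one vanishing on each line. *)
Lemma nonzero_form_in_ideal : (2 <= n)%N ->
  exists d (f : S), [/\ f \is d.-homog, f \in J & f != 0].
Proof.
move=> n2.
suff [d [f [fd f0 fM]]] : exists d (f : S),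
    [/\ f \is d.-homog, f != 0 & {in enum 'I_m, forall i, vanishes_on (M i) f}].
  exists d, f; split=> //; apply/(homog_lines_ideal M fd) => i.
  by apply: fM; rewrite mem_enum.
elim: (enum 'I_m) => [|i r [d [f [fd f0 fM]]]].
  by exists 0%N, 1; split=> //; [exact: dhomog1|exact: oner_neq0].
have [x xM] : exists x, x \notin cone (M i).
  apply: contrapT => h; have : cone (M i) = fullv.
    apply/eqP; rewrite eqEsubv subvf; apply/subvP => x _.
    by apply: contrapT => /negP xM; apply: h; exists x.
  move/(congr1 (fun U => \dim U)); rewrite dim_cone dimvf dim_matrix; lia.
have [a [aM ax]] := separating_linear_form xM.
exists (1 + d)%N, (linear_form a * f); split.
- by apply: dhomogM => //; exact: linear_form_homog.
- rewrite mulf_neq0 //; apply: contra_neq ax => a0.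
  by rewrite -meval_linear_form a0 meval0.
- move=> j; rewrite inE => /orP[/eqP->|jr] y yM; rewrite mevalM.
    by rewrite (aM _ yM) mul0r.
  by rewrite (fM _ jr _ yM) mulr0.
Qed.

Hypotheses (J1 : 1 \notin J)
  (J2 : forall f, f \is 2.-homog -> f \in J -> f = 0) (n2 : (2 <= n)%N).

Lemma lowest_form : exists s (f : S),
  [/\ f \is s.+3.-homog, f \in J, f != 0 &
      forall d g, (d < s.+3)%N -> g \is d.-homog -> g \in J -> g = 0].
Proof.
pose P d := `[< exists f : S, [/\ f \is d.-homog, f \in J & f != 0] >].
have exP : exists d, P d.
  by have [d [f h]] := nonzero_form_in_ideal n2; exists d; apply/asboolP; exists f.
case: (ex_minnP exP) => s /asboolP[f [fs fJ f0]] smin.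
have s3 : (2 < s)%N.
  rewrite ltnNge; apply/negP => s2.
  (* A form of degree at most 2 in the ideal is raised to a quadric of the ideal by a power of a
     variable. *)
  have : 'X_ord0 ^+ (2 - s) * f = 0.
    apply: J2; last exact: lines_idealM.
    have e2 : (1 * (2 - s) + s = 2)%N by lia.
    rewrite -[X in X.-homog]e2.
    by apply: dhomogM => //; apply: dhomogMn; rewrite dhomogX /= mdeg1.
  move/eqP; rewrite mulf_eq0 (negPf f0) orbF expf_eq0 => /andP[_ /eqP X0].
  have := congr1 (fun p : S => p.@[fun=> 1]) X0.
  by rewrite mevalXU meval0 => /eqP; rewrite oner_eq0.
exists (s - 3)%N, f; have -> : ((s - 3).+3 = s)%N by lia.
split=> // d g ds gd gJ; apply: contraTeq ds => g0.
by rewrite -leqNgt; apply: smin; apply/asboolP; exists g.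
Qed.

(** Let [c] lift a degree 0 row with augmentation 1, and write [f] as [Fr *m X]. In the polynomial
    ring, [X *m c = W *m D0] and [Fr *m W = V *m D1], so [f *: c] equals [V *m D1 *m D0], which is
    zero. *)
Lemma no_quadrics_not_Koszul : ~ Koszul gr.
Proof.
case=> res; have [s [f [fs fJ f0 low]]] := lowest_form.
(* Below the degree of [f] the ideal is zero, so homogeneous identities of the quotient hold in the
   polynomial ring. *)
have lowmx d p q (X Y : 'M[S]_(p, q)) : (d < s.+3)%N ->
    homog_mx d X -> homog_mx d Y -> pi_mx X = pi_mx Y -> X = Y.
  move=> ds Xd Yd XY; apply/matrixP => i j; apply/eqP; rewrite -subr_eq0.
  apply/eqP; apply: low ds _ _; first by rewrite rpredB ?Xd ?Yd.
  by apply/pi_eq; move/matrixP/(_ i j): XY; rewrite !mxE.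
have [u uP] := res_aug_surj res.
pose u0 := map_mx (component 0) u.
have u0g : row_gr 0 u0 by exact: component_row_gr.
have u0aug : (u0 *m res_aug res) 0 0 = 1.
  move/irrelevantP: uP; rewrite componentD -[X in _ + component 0 (- X)]/(\pi_A 1).
  have -> : - \pi_A 1 = \pi_A (-1) :> A by rewrite !piE.
  rewrite component_pi pihomog_dE ?rpredN ?dhomog1 // => h.
  have -> : (u0 *m res_aug res) 0 0 = component 0 ((u *m res_aug res) 0 0).
    rewrite !mxE component_sum; apply: eq_bigr => k _.
    by rewrite (componentM _ _ (res_aug_homog k)) subn0 mxE.
  apply/eqP; rewrite -subr_eq0; apply/eqP; rewrite -[RHS]h; congr (_ + _).
  by rewrite -[1]/(\pi_A 1) !piE.
have [D0 D0h D0E] := lift_mx (@res_diff_homog _ _ res 0).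
have [D1 D1h D1E] := lift_mx (@res_diff_homog _ _ res 1).
have D10 : D1 *m D0 = 0.
  apply: (lowmx 2) => //; first exact: (@homog_mxM 1 1).
    by move=> i j; rewrite mxE; exact: dhomog0.
  rewrite pi_mxM D1E D0E; apply/row_matrixP => p; rewrite row_mul.
  have -> : row p (res_diff res 1) *m res_diff res 0 = 0.
    apply/res_diff_exact; exists (delta_mx 0 p); exact: rowE.
  by apply/rowP => j; rewrite !mxE pi0.
have row_gr_mx d p (w : 'rV[A]_p) : row_gr d w -> forall i j, gr d (w i j).
  by move=> wd i j; rewrite ord1.
have [c ch cE] := lift_mx (row_gr_mx _ _ _ u0g).
have X1 j : ('X_j : S) \is 1.-homog by rewrite dhomogX /= mdeg1.
have /choice[w wP] : forall j : 'I_n.+1, exists w,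
    row_gr 0 w /\ \pi_A 'X_j *: u0 = w *m res_diff res 0.
  move=> j; have [|w w0 wE] := @strand_surjective _ _ _ _ res 0 (\pi_A 'X_j *: u0).
    by move=> i; rewrite mxE; apply: (@grM _ _ _ _ 1 0) => //; exists 'X_j.
  by exists w.
have [W Wh WE] : exists2 W : 'M[S]_(n.+1, _), homog_mx 0 W &
    pi_mx W = \matrix_j w j.
  by apply: lift_mx => j l; rewrite mxE; case: (wP j).
pose X : 'cV[S]_n.+1 := \col_j 'X_j.
have Xh : homog_mx 1 X by move=> i j; rewrite mxE.
have XcE : X *m c = W *m D0.
  apply: (lowmx 1) => //; [exact: (@homog_mxM 1 0)|exact: (@homog_mxM 0 1)|].
  rewrite !pi_mxM cE WE D0E; apply/row_matrixP => j.
  rewrite row_mul row_mul rowK -(proj2 (wP j)).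
  by apply/rowP => l; rewrite !mxE big_ord1 !mxE.
have [F Fh FE] := homogS_decomposition fs.
pose Fr : 'rV[S]_n.+1 := \row_j F j.
have Frh : homog_mx s.+2 Fr by move=> i j; rewrite mxE.
have fE : f *: c = Fr *m X *m c.
  have -> : Fr *m X = f%:M.
    apply/matrixP => i j; rewrite !ord1 !mxE eqxx mulr1n FE.
    by apply: eq_bigr => l _; rewrite !mxE.
  by rewrite mul_scalar_mx.
have FWh : row_gr s.+2 (pi_mx (Fr *m W)).
  move=> l; rewrite mxE; exists ((Fr *m W) 0 l) => //.
  by rewrite -[s.+2]addn0; exact: homog_mxM.
(* [f *: c] vanishes in the quotient, so [Fr *m W] is a cycle, hence a boundary; its degree [s.+2]
   is still low enough to lift this. *)
have FWE : pi_mx (Fr *m W) *m res_diff res 0 = 0.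
  rewrite -D0E -pi_mxM -mulmxA -XcE mulmxA -fE; apply/rowP => l; rewrite !mxE.
  by apply/pi_eq0; rewrite mulrC; exact: lines_idealM.
have [v vh vE] := proj1 (strand_exact FWh) FWE.
have [V Vh VE] := lift_mx (row_gr_mx _ _ _ vh).
have FWVE : Fr *m W = V *m D1.
  apply: (lowmx s.+2) => //.
  - by rewrite -[s.+2]addn0; exact: homog_mxM.
  - by rewrite -[s.+2]addn1; exact: homog_mxM.
  - by rewrite vE pi_mxM VE D1E.
have fc0 : f *: c = 0.
  by rewrite fE -mulmxA XcE mulmxA FWVE -mulmxA D10 mulmx0.
have c0 : c = 0.
  apply/rowP => l; move/rowP/(_ l): fc0; rewrite !mxE => /eqP.
  by rewrite mulf_eq0 (negPf f0) => /eqP.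
move: u0aug; rewrite -cE c0 mxE big1 => [|l _]; last by rewrite !mxE pi0 mul0r.
rewrite -pi0 => /esym/pi_eq; rewrite subr0 => J1'.
by move: J1; rewrite J1'.
Qed.

End NoQuadrics.

(** * Lines imposing independent conditions on quadrics *)

Lemma homog0_const (K : fieldType) k (f : {mpoly K[k]}) :
  f \is 0.-homog -> f = (f@_0)%:MP.
Proof.
move=> f0; apply/mpolyP => mon; rewrite mcoeffC.
have [->|mon0] := eqVneq mon 0%MM; first by rewrite mulr1.
by rewrite mulr0 (dhomog_nemf_coeff f0) // mdeg_eq0.
Qed.

Lemma poly_eq0_of_roots (K : numFieldType) (p : {poly K}) :
  (forall x, p.[x] = 0) -> p = 0.
Proof.
move=> p0; apply/eqP; apply: contraT => pn0.
have := max_poly_roots pn0 (rs := [seq i%:R | i <- iota 0 (size p)]).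
rewrite size_map size_iota ltnn; apply.
  by apply/allP => x _; apply/rootP.
rewrite map_inj_uniq ?iota_uniq // => i j /eqP.
by rewrite eqr_nat => /eqP.
Qed.

(** * Restriction of forms to a parametrized line *)

Section Restriction.
Variables (K : numFieldType) (n : nat).
Local Notation S := {mpoly K[n.+1]}.
Implicit Types (u v : 'rV[K]_n.+1) (f : S).

Definition restrict f u v (s t : K) := f.@[fun j => (s *: u + t *: v) 0 j].

Lemma restrict_linear_form a u v s t :
  restrict (linear_form a) u v s t = s * (a *m u^T) 0 0 + t * (a *m v^T) 0 0.
Proof.
rewrite /restrict meval_linear_form linearD !linearZ /= mulmxDr -!scalemxAr.
by rewrite !mxE.
Qed.

Lemma restrict_homog d f u v : f \is d.-homog -> exists c : nat -> K,
  forall s t, restrict f u v s t = \sum_(j < d.+1) c j * (s ^+ j * t ^+ (d - j)).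
Proof.
elim: d f => [|d IH] f fd.
  exists (fun=> f@_0) => s t; rewrite big_ord1 !mulr1 /restrict.
  by rewrite {1}(homog0_const fd) mevalC.
have [F Fd ->] := homogS_decomposition fd.
have /choice[c cE] := fun j => IH _ (Fd j).
(* Multiplication by [s * u 0 k + t * v 0 k]: the first term shifts the exponent of [s], the second
   keeps it. *)
exists (fun j => \sum_k ((if j is j'.+1 then u 0 k * c k j' else 0) +
    (if (j <= d)%N then v 0 k * c k j else 0))) => s t.
rewrite /restrict raddf_sum /=.
under [RHS]eq_bigr do rewrite mulr_suml.
rewrite exchange_big /=; apply: eq_bigr => k _.
rewrite mevalM mevalXU -/(restrict _ u v s t) cE.
under [RHS]eq_bigr do rewrite mulrDl.
rewrite big_split /= [X in _ = X + _]big_ord_recl /= mul0r add0r.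
rewrite [X in _ = _ + X]big_ord_recr /= ltnn mul0r addr0.
rewrite !mxE mulrDr !mulr_suml; congr (_ + _); apply: eq_bigr => j _.
  by rewrite /bump /= add1n subSS exprS; ring.
have -> : (j <= d)%N by rewrite -ltnS.
by rewrite subSn -1?ltnS // exprS; ring.
Qed.

Definition quadratic_form (c : 'cV[K]_#|{: upper_pair n.+1}|) : S :=
  \sum_r c r 0 *: ('X_(val (enum_val r)).1 * 'X_(val (enum_val r)).2).

Lemma quadratic_form_homog c : quadratic_form c \is 2.-homog.
Proof.
apply: rpred_sum => r _; rewrite rpredZ // -[2%N]/(1 + 1)%N dhomogM //;
by rewrite dhomogX /= mdeg1.
Qed.

Lemma restrict_quadratic_form c u v s t :
  restrict (quadratic_form c) u v s t =
    s ^+ 2 * (square_row u *m c) 0 0 + s * t * (polar_row u v *m c) 0 0 +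
    t ^+ 2 * (square_row v *m c) 0 0.
Proof.
rewrite /restrict raddf_sum /= !mxE !mulr_sumr -!big_split /=.
by apply: eq_bigr => r _; rewrite mevalZ mevalM !mevalXU !mxE; ring.
Qed.

Lemma homog2_quadratic_form f :
  f \is 2.-homog -> exists c, f = quadratic_form c.
Proof.
pose isQ (g : S) := exists c, g = quadratic_form c.
have QD g1 g2 : isQ g1 -> isQ g2 -> isQ (g1 + g2).
  move=> [c1 ->] [c2 ->]; exists (c1 + c2); rewrite /quadratic_form -big_split.
  by apply: eq_bigr => r _; rewrite mxE scalerDl.
have Q0 : isQ 0.
  by exists 0; rewrite /quadratic_form big1 // => r _; rewrite mxE scale0r.
have QX (a : K) (i j : 'I_n.+1) : isQ (a *: ('X_i * 'X_j)).
  wlog ij : i j / (i <= j)%N => [th|].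
    by case: (leqP i j) => [/th//|/ltnW/th]; rewrite mulrC.
  pose r := enum_rank (exist (fun p : 'I_n.+1 * 'I_n.+1 => p.1 <= p.2)%N (i, j) ij).
  exists (a *: delta_mx r 0); rewrite /quadratic_form (bigD1 r) //= big1.
    by rewrite addr0 enum_rankK !mxE !eqxx mulr1.
  by move=> r' r'r; rewrite !mxE (negPf r'r) mulr0 scale0r.
move=> f2; have [F F1 ->] := homogS_decomposition f2.
apply: (big_ind isQ) => // j _; have [G G0 ->] := homogS_decomposition (F1 j).
rewrite mulr_suml; apply: (big_ind isQ) => // i _.
by rewrite (homog0_const (G0 i)) mul_mpolyC -scalerAl.
Qed.

Lemma binary_form_eq0 d (c : nat -> K) :
  (forall s t, \sum_(j < d.+1) c j * (s ^+ j * t ^+ (d - j)) = 0) ->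
  forall j, (j <= d)%N -> c j = 0.
Proof.
move=> c0 j jd; have p0 : \poly_(i < d.+1) c i = 0.
  apply: poly_eq0_of_roots => x; rewrite horner_poly -[RHS](c0 x 1).
  by apply: eq_bigr => i _; rewrite expr1n mulr1.
have := congr1 (fun p : {poly K} => p`_j) p0.
by rewrite coef_poly coef0 ltnS jd.
Qed.

End Restriction.

Section LinesBasis.
Variables (K : numFieldType) (n m : nat) (M : 'I_m -> line K n).
Local Notation S := {mpoly K[n.+1]}.
Local Notation J := (lines_ideal M).
Variables u v : 'I_m -> 'rV[K]_n.+1.
Hypotheses (uM : forall i, u i \in cone (M i)) (vM : forall i, v i \in cone (M i)).

(** Restriction from forms of degree [d] to families of binary forms, one per line, is onto: the
    conditions of the lines are independent. *)
Definition separates_lines d := forall i j, (j <= d)%N ->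
  exists2 f : S, f \is d.-homog & forall i' s t,
    restrict f (u i') (v i') s t = (i' == i)%:R * (s ^+ j * t ^+ (d - j)).

Lemma separates_lines2 : row_free (quadrics_mx u v) -> separates_lines 2.
Proof.
move=> /row_freeP[C QC] i j j2.
(* Rows of [quadrics_mx] are ordered by the exponent of [t], which is [2 - j] for the monomial
   sought; a column of the right inverse is then the required quadric. *)
have rj : (2 - j < 3)%N by lia.
pose r := enum_rank (i, Ordinal rj).
exists (quadratic_form (col r C)) => [|i' s t].
  exact: quadratic_form_homog.
have rowE k : (plane_row (u i') (v i') k *m col r C) 0 0 =
    ((i' == i) && (k == 2 - j :> nat)%N)%:R.
  have -> : plane_row (u i') (v i') k = row (enum_rank (i', k)) (quadrics_mx u v).
    by rewrite rowK enum_rankK.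
  rewrite colE mulmxA -colE -row_mul QC !mxE (inj_eq enum_rank_inj).
  by rewrite xpair_eqE -val_eqE.
rewrite restrict_quadratic_form.
have := rowE 0; have := rowE 1; have := rowE 2%:R; rewrite /plane_row /= => -> -> ->.
case: eqP => _; last by rewrite !mulr0 !addr0 mul0r.
by case: j j2 {rj r rowE} => [|[|[|]]] // _;
  rewrite /= ?subn0 ?subnn ?mulr0 ?mulr1 ?mul1r ?addr0 ?add0r.
Qed.

Hypothesis sep2 : separates_lines 2.

(** Both s^2 and t^2 are restrictions of quadrics to the line, and every quadric vanishes at the
    origin. *)
Lemma param_inj i s t : s *: u i + t *: v i = 0 -> s = 0 /\ t = 0.
Proof.
move=> st0.
have h (f : S) : f \is 2.-homog -> restrict f (u i) (v i) s t = 0.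
  move=> f2; rewrite /restrict st0.
  have [F _ ->] := homogS_decomposition f2.
  by rewrite raddf_sum big1 //= => j _; rewrite mevalM mevalXU mxE mulr0.
have [f /h f2 fE] := sep2 i (isT : 2 <= 2)%N.
have [g /h g2 gE] := sep2 i (isT : 0 <= 2)%N.
move: f2 g2; rewrite fE gE eqxx !mul1r !mulr1 => /eqP + /eqP.
by rewrite !expf_eq0 /= => /eqP-> /eqP->.
Qed.

Lemma coneP i x : reflect (exists s t, x = s *: u i + t *: v i) (x \in cone (M i)).
Proof.
have fr : free [:: u i; v i].
  rewrite free_cons seq1_free span_seq1; apply/andP; split.
    apply/vlineP => -[k uk]; have : 1 *: u i + (- k) *: v i = 0.
      by rewrite scale1r uk scaleNr subrr.
    by move=> /param_inj[/eqP]; rewrite oner_eq0.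
  apply/eqP => v0; have : 0 *: u i + 1 *: v i = 0 by rewrite v0 scale0r scaler0 addr0.
  by move=> /param_inj[_ /eqP]; rewrite oner_eq0.
have -> : (cone (M i) : {vspace _}) = <<[:: u i; v i]>>%VS.
  apply/esym/eqP; rewrite eqEdim dim_cone.
  have -> : \dim <<[:: u i; v i]>> = 2%N by move: fr; rewrite /free => /eqP.
  rewrite andbT; apply/span_subvP => y; rewrite !inE.
  by move=> /orP[] /eqP->.
rewrite span_cons span_seq1; apply: (iffP memv_addP).
  by case=> _ /vlineP[s ->] [_ /vlineP[t ->] ->]; exists s, t.
case=> s [t ->]; exists (s *: u i); first exact: memvZ (memv_line _).
by exists (t *: v i) => //; exact: memvZ (memv_line _).
Qed.

(** Multiply by a linear form restricting to s or to t on line [i]; on the other lines the product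
    is zero already. *)
Lemma separates_linesS d : separates_lines d -> separates_lines d.+1.
Proof.
move=> sep i j jd.
(* The columns of [B] are linear forms dual to [u i] and [v i]. *)
have [B UB] : exists B, col_mx (u i) (v i) *m B = 1%:M.
  apply/row_freeP/inj_row_free => w.
  rewrite -[w]hsubmxK mul_row_col [lsubmx w]mx11_scalar [rsubmx w]mx11_scalar.
  rewrite !mul_scalar_mx => /param_inj[-> ->].
  by rewrite !raddf0 row_mx0.
rewrite mul_col_mx in UB.
have rowB k (x : 'rV[K]_n.+1) : ((row k B^T) *m x^T) 0 0 = (x *m B) 0 k.
  by rewrite !mxE; apply: eq_bigr => l _; rewrite !mxE mulrC.
have uB k : (u i *m B) 0 k = (k == 0)%:R.
  move/matrixP/(_ 0 k): UB; rewrite mxE; case: splitP => // l _.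
  by rewrite ord1 !mxE => ->; rewrite eq_sym.
have vB k : (v i *m B) 0 k = (k == 1)%:R.
  move/matrixP/(_ 1 k): UB; rewrite mxE; case: splitP => [[[]]//|l _].
  by rewrite ord1 !mxE => ->; rewrite eq_sym.
have ell k : exists2 l : S, l \is 1.-homog & forall s t,
    restrict l (u i) (v i) s t = if k == 0 :> 'I_2 then s else t.
  exists (linear_form (row k B^T)); first exact: linear_form_homog.
  move=> s t; rewrite restrict_linear_form !rowB uB vB.
  by case: k => [[|[|]]] //= k2; rewrite ?mulr1 ?mulr0 ?addr0 ?add0r.
have step k j' : (j' <= d)%N -> exists2 f : S, f \is d.+1.-homog &
    forall i' s t, restrict f (u i') (v i') s t = (i' == i)%:R *
      ((if k == 0 :> 'I_2 then s else t) * (s ^+ j' * t ^+ (d - j'))).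
  move=> jd'; have [f fd fE] := sep i j' jd'; have [l l1 lE] := ell k.
  exists (l * f); first by rewrite -[d.+1]add1n; exact: dhomogM.
  move=> i' s t; rewrite /restrict mevalM -!/(restrict _ _ _ _ _) fE.
  by case: eqP => [->|_]; rewrite ?mul0r ?mulr0 // lE !mul1r.
case: j jd => [|j] jd.
  have [f fd fE] := step 1 0%N (leq0n d); exists f => // i' s t.
  by rewrite fE /= !subn0 exprS; ring.
have [f fd fE] := step 0 j jd; exists f => // i' s t.
by rewrite fE /= subSS exprS; ring.
Qed.

Lemma separates_lines_all d : separates_lines d.+2.
Proof. by elim: d => [//|d]; exact: separates_linesS. Qed.

Lemma homog_lines_idealP d f : f \is d.-homog ->
  f \in J <-> forall i s t, restrict f (u i) (v i) s t = 0.
Proof.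
move=> fd; split=> [/(homog_lines_ideal M fd) h i s t|h].
  by apply: h; apply/coneP; exists s, t.
apply/(homog_lines_ideal M fd) => i x /coneP[s [t ->]]; exact: h.
Qed.

Lemma graded_basisSS d :
  exists beta : 'I_(m * d.+3) -> S, graded_basis M d.+2 beta.
Proof.
have sep := @separates_lines_all d.
have ex i (j : 'I_d.+3) : exists f : S, f \is d.+2.-homog /\ forall i' s t,
    restrict f (u i') (v i') s t = (i' == i)%:R * (s ^+ j * t ^+ (d.+2 - j)).
  by have [|f fd fE] := sep i j; [rewrite -ltnS|exists f].
have /choice[F0 F0E] := fun p : 'I_m * 'I_d.+3 => ex p.1 p.2.
pose F := \matrix_(i, j) F0 (i, j).
have Fd i j : F i j \is d.+2.-homog by rewrite mxE; case: (F0E (i, j)).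
have FE i j i' s t : restrict (F i j) (u i') (v i') s t =
    (i' == i)%:R * (s ^+ j * t ^+ (d.+2 - j)).
  by rewrite mxE; case: (F0E (i, j)).
exists (fun k => mxvec F 0 k).
have sumE (C : 'M[K]_(m, d.+3)) : \sum_k mxvec C 0 k *: mxvec F 0 k =
    \sum_i \sum_j C i j *: F i j.
  rewrite pair_bigA /= (reindex _ (curry_mxvec_bij m d.+3)) /=.
  by apply: eq_bigr => -[i j] _ /=; rewrite !mxvecE.
have sumd (C : 'M[K]_(m, d.+3)) : \sum_i \sum_j C i j *: F i j \is d.+2.-homog.
  by apply: rpred_sum => i _; apply: rpred_sum => j _; rewrite rpredZ.
have sumR (C : 'M[K]_(m, d.+3)) i s t :
    restrict (\sum_i \sum_j C i j *: F i j) (u i) (v i) s t =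
    \sum_(j < d.+3) C i j * (s ^+ j * t ^+ (d.+2 - j)).
  rewrite /restrict raddf_sum (bigD1 i) //= [X in _ + X]big1 ?addr0 => [|i' ii'].
    rewrite raddf_sum; apply: eq_bigr => j _ /=.
    by rewrite mevalZ -/(restrict _ _ _ s t) FE eqxx mul1r.
  rewrite raddf_sum big1 // => j _ /=.
  by rewrite mevalZ -/(restrict _ _ _ s t) FE eq_sym (negPf ii') mul0r mulr0.
split=> [k|f fd|c].
- by case/mxvec_indexP: k => i j; rewrite mxvecE.
- have /choice[c cE] := fun i => restrict_homog (u i) (v i) fd.
  exists (mxvec (\matrix_(i, j) c i j)); rewrite sumE.
  apply/(homog_lines_idealP (d := d.+2)); first by rewrite rpredB ?sumd.
  move=> i s t; rewrite /restrict raddfB /= -!/(restrict _ _ _ s t) sumR cE.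
  by apply/eqP; rewrite subr_eq0; apply/eqP/eq_bigr => j _; rewrite mxE.
- rewrite -(vec_mxK c) sumE => /(homog_lines_idealP (sumd _)) c0.
  suff -> : vec_mx c = 0 by rewrite linear0.
  apply/matrixP => i j; rewrite [RHS]mxE.
  (* Extension by zero to all of [nat], the form in which [binary_form_eq0] takes coefficients. *)
  pose g k := if insub k is Some k' then vec_mx c i k' else 0.
  have gE (k : 'I_d.+3) : vec_mx c i k = g k by rewrite /g valK.
  rewrite gE; apply: (@binary_form_eq0 _ d.+2 g) => [s t|]; last by rewrite -ltnS.
  rewrite -[RHS](c0 i s t) sumR; apply: eq_bigr => k _; rewrite -gE //.
Qed.

Lemma graded_basis0 : (0 < m)%N ->
  exists beta : 'I_1 -> S, graded_basis M 0 beta.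
Proof.
move=> m0; exists (fun=> 1); split=> [_|f f0|c]; first exact: dhomog1.
  exists (f@_0)%:M; rewrite big_ord1 mxE eqxx mulr1n {1}(homog0_const f0).
  by rewrite -mul_mpolyC mulr1 subrr rpred0.
rewrite big_ord1 => /asboolP/(_ (Ordinal m0))/line_ideal_vanishes/(_ 0 (mem0v _)).
rewrite mevalZ meval1 mulr1 => c0; apply/rowP => k.
by rewrite ord1 c0 mxE.
Qed.

Lemma graded_basis1 (u' v' : 'I_m -> 'rV[K]_n.+1) :
  (forall i, u' i \in cone (M i)) -> (forall i, v' i \in cone (M i)) ->
  \rank (linear_mx u' v') = n.+1 ->
  exists beta : 'I_n.+1 -> S, graded_basis M 1 beta.
Proof.
move=> uM' vM' rk; exists (fun j => 'X_j); split=> [j|f f1|c].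
- by rewrite dhomogX /= mdeg1.
- have [F F0 FE] := homogS_decomposition f1; exists (\row_j (F j)@_0).
  rewrite FE -sumrB big1 ?rpred0 // => j _.
  by rewrite mxE {1}(homog0_const (F0 j)) mul_mpolyC subrr.
rewrite -/(linear_form c) => /(homog_lines_ideal M (linear_form_homog c)) cM.
have uc i x : x \in cone (M i) -> x *m c^T = 0.
  move=> /(cM i); rewrite meval_linear_form => cx.
  by apply: trmx_inj; rewrite trmx_mul trmxK [LHS]mx11_scalar cx raddf0 trmx0.
have : row_free (linear_mx u' v')^T by rewrite /row_free mxrank_tr rk.
move/row_freeP => [B LB]; rewrite -[c]mulmx1 -LB mulmxA.
suff -> : c *m (linear_mx u' v')^T = 0 by rewrite mul0mx.
apply: trmx_inj; rewrite trmx_mul trmxK trmx0 mul_col_mx.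
apply/eqP; rewrite col_mx_eq0; apply/andP.
by split; apply/eqP/row_matrixP => i; rewrite row_mul rowK row0 (uc i).
Qed.

End LinesBasis.

(** * Generic lines *)

Section GenericLines.
Variables (K : numFieldType) (n m : nat) (M : 'I_m -> line K n).
Local Notation S := {mpoly K[n.+1]}.
Hypothesis genM : generic_lines M.

Lemma generic_quadrics : (3 <= n)%N ->
  exists u v : 'I_m -> 'rV[K]_n.+1,
  [/\ forall i, u i \in cone (M i), forall i, v i \in cone (M i) &
      (minn (3 * m) #|{: upper_pair n.+1}| <= \rank (quadrics_mx u v))%N].
Proof.
case: n M genM => // k M' [a [indep aM]] k3.
have [u0 [v0 <-]] := @special_quadrics k.+2 m k3.
have [u [v [au av le]]] := generic_kernel_rank u0 v0 indep
  (@quadrics_mx_natural k.+2 m) (@quadrics_mx_span_monotone k.+2 m).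
by exists u, v; split=> // i; rewrite (generated_line_ideal_cone (aM i)) (au, av).
Qed.

Lemma generic_linear : (1 <= n)%N -> (n.+1 <= 2 * m)%N ->
  exists u v : 'I_m -> 'rV[K]_n.+1,
  [/\ forall i, u i \in cone (M i), forall i, v i \in cone (M i) &
      \rank (linear_mx u v) = n.+1].
Proof.
case: n M genM => // k M' [a [indep aM]] _ km.
have [u0 [v0 rk]] := special_linear km.
have [u [v [au av]]] := generic_kernel_rank u0 v0 indep
  (@linear_mx_natural k.+2 m) (@linear_mx_span_monotone k.+2 m).
rewrite rk => le; exists u, v; split.
- by move=> i; rewrite (generated_line_ideal_cone (aM i)) au.
- by move=> i; rewrite (generated_line_ideal_cone (aM i)) av.
- by apply/eqP; rewrite eqn_leq rank_leq_col.
Qed.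

Lemma one_notin_lines_ideal : (0 < m)%N -> 1 \notin lines_ideal M.
Proof.
move=> m0; apply/negP => /(homog_lines_ideal M (dhomog1 _ _)).
move=> /(_ (Ordinal m0) 0 (mem0v _)) /eqP.
by rewrite meval1 oner_eq0.
Qed.

Lemma generic_no_quadrics : (3 <= n)%N -> (#|{: upper_pair n.+1}| <= 3 * m)%N ->
  forall f : S, f \is 2.-homog -> f \in lines_ideal M -> f = 0.
Proof.
move=> n3 Nm f f2 fM; have [u [v [uM vM]]] := generic_quadrics n3.
move: fM; rewrite (minn_idPr Nm) => /(homog_lines_ideal M f2) fM rk.
have [c fE] := homog2_quadratic_form f2.
have st i s t : restrict f (u i) (v i) s t = 0.
  by apply: fM (i) _ _; rewrite memvD ?memvZ.
have c0 : quadrics_mx u v *m c = 0.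
  apply/row_matrixP => r; rewrite row_mul rowK row0; set i := (enum_val r).1.
  (* These three parameter values recover the three coefficients of the restricted quadric. *)
  have := st i 1 1; have := st i 0 1; have := st i 1 0.
  rewrite fE !restrict_quadratic_form !expr0n !expr1n /= !(mul1r, mul0r, add0r, addr0).
  move=> h1 h2; rewrite h1 h2 add0r addr0 => h3.
  rewrite [LHS]mx11_scalar /plane_row; case: ifP => _; last case: ifP => _;
  by rewrite ?h1 ?h2 ?h3 raddf0.
have /row_freeP[B cB] : row_free (quadrics_mx u v)^T.
  by rewrite /row_free mxrank_tr eqn_leq rank_leq_col.
rewrite fE; have -> : c = 0.
  apply: trmx_inj; rewrite trmx0 -[c^T]mulmx1 -cB mulmxA -trmx_mul c0.
  by rewrite trmx0 mul0mx.
by rewrite /quadratic_form big1 // => r _; rewrite mxE scale0r.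
Qed.

Definition lines_hilbert (d : nat) : nat :=
  if d is d'.+2 then (m * d'.+3)%N else if d is 1 then n.+1 else 1.

Lemma generic_graded_basis : (3 <= n)%N -> (n.+1 <= 2 * m)%N ->
  (3 * m <= #|{: upper_pair n.+1}|)%N ->
  forall d, exists beta : 'I_(lines_hilbert d) -> S, graded_basis M d beta.
Proof.
move=> n3 nm mN [|[|d]].
- by apply: graded_basis0; lia.
- have [u [v [uM vM rk]]] := generic_linear (ltnW (ltnW n3)) nm.
  exact: graded_basis1 uM vM rk.
have [u [v [uM vM]]] := generic_quadrics n3.
rewrite (minn_idPl mN) => rk; apply: graded_basisSS uM vM _ _.
apply: separates_lines2; rewrite /row_free eqn_leq rank_leq_row.
rewrite /=; apply: leq_trans rk.
by rewrite card_prod !card_ord mulnC.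
Qed.

End GenericLines.

Theorem theorem5p2 (R : realType) (n m : nat) (M : 'I_m -> line R[i] n)
    (hn : (3 <= n)%N) (hM : generic_lines M)
    (hm : m%:R > 72%:R^-1 *
            (3%:R * (n%:R ^+ 2 + 10%:R * n%:R + 13%:R) +
             Num.sqrt (3%:R * (n%:R - 1) ^+ 3 * (3%:R * n%:R + 5%:R))) :> R) :
  ~ Koszul (coordinate_grading M).
Proof.
(* Dropping the square root from the bound is enough here. It ensures that the lines can span the
   whole space, which gives h(1) = n + 1. *)
have nm : (n.+1 <= 2 * m)%N.
  have : (3 * (n ^ 2 + 10 * n + 13) < 72 * m)%N.
    rewrite -(ltr_nat R) !(natrM, natrD, natrX).
    move: hm; have := sqrtr_ge0 (3%:R * (n%:R - 1) ^+ 3 * (3%:R * n%:R + 5%:R) : R).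
    by move: (Num.sqrt _) => x; lra.
  by nia.
have J1 : 1 \notin lines_ideal M by apply: one_notin_lines_ideal; lia.
have [mN|/ltnW Nm] := leqP (3 * m) #|{: upper_pair n.+1}|; last first.
  by apply: no_quadrics_not_Koszul J1 (generic_no_quadrics hM hn Nm) (ltnW hn).
case=> res; have basis := generic_graded_basis hM hn nm mN.
have [rho [rhoS rho0 rho_0]] := Koszul_strand_ranks res
  (fun d => projT2 (cid (basis d))).
have rec := strand_recurrence R rhoS rho0 rho_0 erefl erefl (fun=> erefl).
apply: (@lines_recurrence_sign R n m (fun d => (res_rank res d)%:R)) => //.
  by rewrite ltr0n; exact: res_rank_gt0.
Qed.
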